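(* Let $(\mathfrak{g},\circ_{\mathfrak{g}})$ be a pre-Lie algebra and let $(V,\circ_l,\circ_r)$ be a representation of $\mathfrak{g}$. Then there is a bijection between the set $\mathrm{CExt}(\mathfrak{g},V)$ of equivalence classes of crossed module extensions of $\mathfrak{g}$ by $V$ inducing the given representation of $\mathfrak{g}$ on $V$, and the third cohomology $H^3(\mathfrak{g},V)$ of the pre-Lie algebra $\mathfrak{g}$ with coefficients in $V$.
   Context: All vector spaces are over a fixed ground field. **Pre-Lie algebra.** A pre-Lie algebra $(\mathfrak{g},\circ)$ is a vector space $\mathfrak{g}$ with a bilinear map $\circ:\mathfrak{g}\otimes\mathfrak{g}\to\mathfrak{g}$ such that $(x\circ y)\circ z-x\circ(y\circ z)=(y\circ x)\circ z-y\circ(x\circ z)$ for all $x,y,z\in\mathfrak{g}$. The bracket $[x,y]:=x\circ y-y\circ x$ is a Lie bracket on $\mathfrak{g}$; the resulting Lie algebra is the sub-adjacent Lie algebra $\mathfrak{g}^c$. Homomorphisms of pre-Lie algebras are linear maps preserving $\circ$; $\mathbf{preLie}$ is the resulting category. **Representation.** A representation of $(\mathfrak{g},\circ)$ is a triple $(V,\circ_l,\circ_r)$ where $V$ is a vector space, $\circ_l:\mathfrak{g}\otimes V\to V$ is a representation of the Lie algebra $\mathfrak{g}^c$ on $V$ (i.e. $[x,y]\circ_l u=x\circ_l(y\circ_l u)-y\circ_l(x\circ_l u)$), and $\circ_r:V\otimes\mathfrak{g}\to V$ is bilinear with $(x\circ_l u)\circ_r y-x\circ_l(u\circ_r y)=(u\circ_r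 x)\circ_r y-u\circ_r(x\circ y)$ for all $x,y\in\mathfrak{g}$, $u\in V$. **Action.** For pre-Lie algebras $(\mathfrak{m},\circ_m)$, $(\mathfrak{n},\circ_n)$, an action of $\mathfrak{n}$ on $\mathfrak{m}$ is a representation $(\circ_l,\circ_r)$ of $\mathfrak{n}$ on the vector space $\mathfrak{m}$ such that for all $x\in\mathfrak{n}$, $u,v\in\mathfrak{m}$: $(x\circ_l u)\circ_m v-x\circ_l(u\circ_m v)=(u\circ_r x)\circ_m v-u\circ_m(x\circ_l v)$ and $(u\circ_m v)\circ_r x-u\circ_m(v\circ_r x)=(v\circ_m u)\circ_r x-v\circ_m(u\circ_r x)$. **Crossed module.** Given an action $(\circ_l,\circ_r)$ of $\mathfrak{n}$ on $\mathfrak{m}$, a crossed module $(\mathfrak{m}\xrightarrow{\mu}\mathfrak{n},\circ_l,\circ_r)$ is a homomorphism $\mu:\mathfrak{m}\to\mathfrak{n}$ of pre-Lie algebras such that for all $x\in\mathfrak{n}$, $u,v\in\mathfrak{m}$: $\mu(u\circ_r x)=\mu(u)\circ_n x$, $\mu(x\circ_l u)=x\circ_n\mu(u)$, and $\mu(u)\circ_l v=u\circ_m v=u\circ_r\mu(v)$. **Crossed module extension.** Let $V$ be a representation of $\mathfrak{g}$, regarded as a pre-Lie algebra with zero product. A crossed module extension of $\mathfrak{g}$ by $V$ is an exact sequence in $\mathbf{preLie}$ $$0\to V\xrightarrow{i}\mathfrak{m}\xrightarrow{\mu}\mathfrak{n}\xrightarrow{\pi}\mathfrak{g}\to0$$ together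 with an action of $\mathfrak{n}$ on $\mathfrak{m}$ making $\mathfrak{m}\xrightarrow{\mu}\mathfrak{n}$ a crossed module. Such an extension induces a representation of $\mathfrak{g}$ on $V$: for any linear section $\rho:\mathfrak{g}\to\mathfrak{n}$ of $\pi$ (so $\pi\rho=\mathrm{id}$), put $i(x\circ_l u):=\rho(x)\circ_l i(u)$ and $i(u\circ_r x):=i(u)\circ_r\rho(x)$ for $x\in\mathfrak{g}$, $u\in V$; this does not depend on $\rho$. **Equivalence.** Two crossed module extensions $E:0\to V\xrightarrow{i}\mathfrak{m}\xrightarrow{\mu}\mathfrak{n}\xrightarrow{\pi}\mathfrak{g}\to0$ and $E':0\to V\xrightarrow{i'}\mathfrak{m}'\xrightarrow{\mu'}\mathfrak{n}'\xrightarrow{\pi'}\mathfrak{g}\to0$ are elementary equivalent, written $E\hookrightarrow E'$, if there are pre-Lie homomorphisms $r:\mathfrak{m}\to\mathfrak{m}'$ and $s:\mathfrak{n}\to\mathfrak{n}'$ with $r i=i'$, $s\mu=\mu' r$, $\pi' s=\pi$, and $r(u\circ_r x)=r(u)\circ_r s(x)$, $r(x\circ_l u)=s(x)\circ_l r(u)$ for all $x\in\mathfrak{n}$, $u\in\mathfrak{m}$. Equivalence $\sim$ is the equivalence relation generated by $\hookrightarrow$ (i.e. extensions connected by a finite zigzag of elementary equivalences). $\mathrm{CExt}(\mathfrak{g},V)$ is the set of $\sim$-classes of crossed module extensions of $\mathfrak{g}$ by $V$ which induce the given representation of $\mathfrak{g}$ on $V$. **Cohomology.** $C^n(\mathfrak{g},V)=\mathrm{Hom}(\wedge^{n-1}\mathfrak{g}\otimes\mathfrak{g},V)$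 for $n\ge1$, with coboundary $d:C^n(\mathfrak{g},V)\to C^{n+1}(\mathfrak{g},V)$, $$\begin{aligned}(df)(x_1,\dots,x_{n+1})=&\sum_{i=1}^n(-1)^{i+1}x_i\circ_l f(x_1,\dots,\hat{x_i},\dots,x_{n+1})+\sum_{i=1}^n(-1)^{i+1}f(x_1,\dots,\hat{x_i},\dots,x_n,x_i)\circ_r x_{n+1}\\&-\sum_{i=1}^n(-1)^{i+1}f(x_1,\dots,\hat{x_i},\dots,x_n,x_i\circ x_{n+1})\\&+\sum_{1\le i<j\le n}(-1)^{i+j}f([x_i,x_j],x_1,\dots,\hat{x_i},\dots,\hat{x_j},\dots,x_{n+1}).\end{aligned}$$ $H^n(\mathfrak{g},V)$ is the $n$-th cohomology of this complex. *)

(* Defs.v *)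
From HB Require Import structures.
From mathcomp Require Import all_boot all_order all_algebra.
From Stdlib Require Import Relation_Operators.

Set Implicit Arguments.
Unset Strict Implicit.
Unset Printing Implicit Defensive.

Import GRing.Theory.
Local Open Scope ring_scope.

(* Vector spaces are modules over a field, of arbitrary dimension. *)

HB.mixin Record isPreLie (k : fieldType) g of GRing.Lmodule k g := {
  circ : g -> g -> g;
  circ_linearl : forall y : g, linear (circ^~ y);
  circ_linearr : forall x : g, linear (circ x);
  circ_preLie : forall x y z : g,
    circ (circ x y) z - circ x (circ y z)
    = circ (circ y x) z - circ y (circ x z)
}.

#[short(type="preLieType")]
HB.structure Definition PreLie (k : fieldType) :=
  {g of isPreLie k g & GRing.Lmodule k g}.

Notation "x ∘ y" := (circ x y) (at level 40, left associativity) : ring_scope.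

Definition bracket (k : fieldType) (g : preLieType k) (x y : g) : g :=
  x ∘ y - y ∘ x.

Record preLie_hom (k : fieldType) (g h : preLieType k) := PreLieHom {
  hom_fun :> {linear g -> h};
  hom_circ : forall x y : g, hom_fun (x ∘ y) = hom_fun x ∘ hom_fun y
}.

(* The vector space V with the zero product. *)
Definition zero_preLie (k : fieldType) (V : lmodType k) : Type := V.

Section ZeroPreLie.
Variables (k : fieldType) (V : lmodType k).

HB.instance Definition _ := GRing.Lmodule.on (zero_preLie V).

Let zero_circ (x y : zero_preLie V) : zero_preLie V := 0.

Fact zero_circ_linearl (y : zero_preLie V) : linear (zero_circ^~ y).
Proof. by move=> a u v; rewrite scaler0 addr0. Qed.

Fact zero_circ_linearr (x : zero_preLie V) : linear (zero_circ x).
Proof. by move=> a u v; rewrite scaler0 addr0. Qed.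

Fact zero_circ_preLie (x y z : zero_preLie V) :
  zero_circ (zero_circ x y) z - zero_circ x (zero_circ y z)
  = zero_circ (zero_circ y x) z - zero_circ y (zero_circ x z).
Proof. by []. Qed.

HB.instance Definition _ := isPreLie.Build k (zero_preLie V)
  zero_circ_linearl zero_circ_linearr zero_circ_preLie.

End ZeroPreLie.

Record representation (k : fieldType) (g : preLieType k) (V : lmodType k) :=
  Representation {
  lact : g -> V -> V;
  ract : V -> g -> V;
  lact_linearl : forall u : V, linear (lact^~ u);
  lact_linearr : forall x : g, linear (lact x);
  ract_linearl : forall x : g, linear (ract^~ x);
  ract_linearr : forall u : V, linear (ract u);
  lact_bracket : forall (x y : g) (u : V),
    lact (bracket x y) u = lact x (lact y u) - lact y (lact x u);
  lact_ract : forall (x y : g) (u : V),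
    ract (lact x u) y - lact x (ract u y) = ract (ract u x) y - ract u (x ∘ y)
}.

Record action (k : fieldType) (n m : preLieType k) := Action {
  action_rep :> representation n m;
  lact_circ : forall (x : n) (u v : m),
    lact action_rep x u ∘ v - lact action_rep x (u ∘ v)
    = ract action_rep u x ∘ v - u ∘ lact action_rep x v;
  ract_circ : forall (x : n) (u v : m),
    ract action_rep (u ∘ v) x - u ∘ ract action_rep v x
    = ract action_rep (v ∘ u) x - v ∘ ract action_rep u x
}.

Record is_crossed_module (k : fieldType) (m n : preLieType k)
    (A : action n m) (mu : preLie_hom m n) : Prop := IsCrossedModule {
  cm_ract : forall (x : n) (u : m), mu (ract A u x) = mu u ∘ x;
  cm_lact : forall (x : n) (u : m), mu (lact A x u) = x ∘ mu u;
  cm_peiffer_l : forall u v : m, lact A (mu u) v = u ∘ v;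
  cm_peiffer_r : forall u v : m, ract A u (mu v) = u ∘ v
}.

Record cm_extension (k : fieldType) (g : preLieType k) (V : lmodType k) :=
  CMExtension {
  ext_m : preLieType k;
  ext_n : preLieType k;
  ext_i : preLie_hom (zero_preLie V) ext_m;
  ext_mu : preLie_hom ext_m ext_n;
  ext_pi : preLie_hom ext_n g;
  ext_act : action ext_n ext_m;
  ext_exactV : injective ext_i;
  ext_exactm : forall u : ext_m, ext_mu u = 0 <-> exists v, u = ext_i v;
  ext_exactn : forall x : ext_n, ext_pi x = 0 <-> exists u, x = ext_mu u;
  ext_exactg : forall z : g, exists x, ext_pi x = z;
  ext_cm : is_crossed_module ext_act ext_mu
}.

Section Extensions.
Variables (k : fieldType) (g : preLieType k) (V : lmodType k).
Implicit Types (E : cm_extension g V) (rV : representation g V).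

Definition induced_along E rV (rho : {linear g -> ext_n E}) : Prop :=
  forall (x : g) (u : V),
    ext_i E (lact rV x u) = lact (ext_act E) (rho x) (ext_i E u)
    /\ ext_i E (ract rV u x) = ract (ext_act E) (ext_i E u) (rho x).

(* Linear sections of ext_pi always exist, and the choice of the section is
   irrelevant: see [induced_along_indep]. *)
Definition induces E rV : Prop :=
  exists2 rho : {linear g -> ext_n E},
    cancel rho (ext_pi E) & induced_along rV rho.

Lemma induced_along_indep E rV (rho rho' : {linear g -> ext_n E}) :
  cancel rho (ext_pi E) -> cancel rho' (ext_pi E) ->
  induced_along rV rho -> induced_along rV rho'.
Proof.
move=> rhoK rhoK' H x u; have [-> ->] := H x u.
have /ext_exactn[w ew] : ext_pi E (rho x - rho' x) = 0.
  by rewrite linearB /= rhoK rhoK' subrr.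
have mu0 : ext_mu E (ext_i E u) = 0 by apply/ext_exactm; exists u.
have [_ _ pl pr] := ext_cm E.
have z1 (a : ext_m E) : a ∘ 0 = 0.
  by have := circ_linearr a 1 0 0; rewrite !scale1r addr0 => /esym/eqP;
     rewrite -subr_eq0 addrK => /eqP.
have z2 (a : ext_m E) : 0 ∘ a = 0.
  by have := circ_linearl a 1 0 0; rewrite !scale1r addr0 => /esym/eqP;
     rewrite -subr_eq0 addrK => /eqP.
have rz (a : ext_m E) : ract (ext_act E) a 0 = 0.
  by have := ract_linearr (ext_act E) a 1 0 0; rewrite !scale1r addr0 =>
     /esym/eqP; rewrite -subr_eq0 addrK => /eqP.
have lz (a : ext_m E) : lact (ext_act E) 0 a = 0.
  by have := lact_linearl (ext_act E) a 1 0 0; rewrite !scale1r addr0 =>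
     /esym/eqP; rewrite -subr_eq0 addrK => /eqP.
have -> : rho x = 1 *: ext_mu E w + rho' x by rewrite -ew scale1r subrK.
have hl := lact_linearl (ext_act E) (ext_i E u) 1 (ext_mu E w) (rho' x).
have hr := ract_linearr (ext_act E) (ext_i E u) 1 (ext_mu E w) (rho' x).
rewrite hl hr !scale1r pl pr -(pr w) -(pl _ w) mu0.
by rewrite rz lz !add0r.
Qed.

Definition elem_equiv E E' : Prop :=
  exists (r : preLie_hom (ext_m E) (ext_m E'))
         (s : preLie_hom (ext_n E) (ext_n E')),
  [/\ forall v, r (ext_i E v) = ext_i E' v,
      forall u, s (ext_mu E u) = ext_mu E' (r u),
      forall x, ext_pi E' (s x) = ext_pi E x,
      forall x u, r (ract (ext_act E) u x) = ract (ext_act E') (r u) (s x)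
    & forall x u, r (lact (ext_act E) x u) = lact (ext_act E') (s x) (r u)].

Definition ext_equiv : cm_extension g V -> cm_extension g V -> Prop :=
  clos_refl_sym_trans _ elem_equiv.

End Extensions.

(* The classes, for an equivalence relation R on T, of the elements of T that
   satisfy D. *)
Record classes (T : Type) (D : T -> Prop) (R : T -> T -> Prop) := Class {
  class_pred :> T -> Prop;
  class_predP : exists2 x, D x & class_pred = R x
}.

Definition CExt (k : fieldType) (g : preLieType k) (V : lmodType k)
    (rV : representation g V) : Type :=
  classes (fun E : cm_extension g V => induces E rV) (@ext_equiv k g V).

Definition upd (T : Type) (m : nat) (x : 'I_m -> T) (i : 'I_m) (a : T)
  : 'I_m -> T := fun j => if j == i then a else x j.

Section Cohomology.
Variables (k : fieldType) (g : preLieType k) (V : lmodType k).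
Variable rV : representation g V.

(* [cochain m] is C^{m+1}(g, V) = Hom(Λ^m g ⊗ g, V), an element of which is
   seen as a function of x_1, ..., x_m and of x_{m+1}, multilinear, and
   alternating in x_1, ..., x_m. *)
Record cochain (m : nat) := Cochain {
  cochain_fun :> ('I_m -> g) -> g -> V;
  cochain_linear : forall x : 'I_m -> g, linear (cochain_fun x);
  cochain_multilinear : forall (x : 'I_m -> g) (i : 'I_m) (y : g),
    linear (fun a : g => cochain_fun (upd x i a) y);
  cochain_alternating : forall (x : 'I_m -> g) (i j : 'I_m) (y : g),
    i != j -> x i = x j -> cochain_fun x y = 0
}.

(* (x_1, ..., x_{m+1}) |-> (x_1, ..., ^x_i, ..., x_{m+1}) *)
Definition del m (x : 'I_m.+1 -> g) (i : 'I_m.+1) : 'I_m -> g :=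
  fun l => x (lift i l).

(* (x_1, ..., x_{m+1}) |-> (a, x_1, ..., ^x_i, ..., ^x_j, ..., x_{m+1}), for
   i < j: then t |-> bump j (bump i t) enumerates increasingly the natural
   numbers other than i and j. *)
Definition del2_cons m (a : g) (x : 'I_m.+1 -> g) (i j : 'I_m.+1) : 'I_m -> g :=
  fun l => if (l : nat) is t.+1 then x (inord (bump j (bump i t))) else a.

(* The coboundary C^{m+1}(g, V) -> C^{m+2}(g, V), with y the last argument.
   Counting the indices from 0 instead of 1 turns the sign (-1)^{i+1} into
   (-1)^i and does not change (-1)^{i+j}. *)
Definition d m (f : ('I_m -> g) -> g -> V) (x : 'I_m.+1 -> g) (y : g) : V :=
    \sum_(i < m.+1) (-1) ^+ i *: lact rV (x i) (f (del x i) y)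
  + \sum_(i < m.+1) (-1) ^+ i *: ract rV (f (del x i) (x i)) y
  - \sum_(i < m.+1) (-1) ^+ i *: f (del x i) (x i ∘ y)
  + \sum_(i < m.+1) \sum_(j < m.+1 | (i < j)%N)
      (-1) ^+ (i + j) *: f (del2_cons (bracket (x i) (x j)) x i j) y.

Definition cocycle m (f : cochain m) : Prop := forall x y, d f x y = 0.

(* C^1 has no nonzero coboundary, since the complex starts in degree 1. *)
Definition coboundary m : (('I_m -> g) -> g -> V) -> Prop :=
  match m with
  | 0 => fun b => forall x y, b x y = 0
  | m'.+1 => fun b => exists h : cochain m', forall x y, b x y = d h x y
  end.

Definition cohomologous m (f f' : cochain m) : Prop :=
  coboundary (fun x y => f' x y - f x y).

(* H^n(g, V), for n >= 1. *)
Definition cohomology (n : nat) : Type :=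
  classes (@cocycle n.-1) (@cohomologous n.-1).

End Cohomology.

(* Main.v *)
Require Import Defs.
From mathcomp Require Import all_boot all_order all_algebra.
From HB Require Import structures.
From mathcomp Require Import boolp functions wochoice.

(* Linear sections rho of pi and sigma of mu turn a crossed module extension E
   into operators of g on m that form an action up to the "defect"
   sigma(x, y), with mu sigma(x, y) = rho x ∘ rho y - rho (x ∘ y); the
   coboundary of the defect takes its values in V, and this 3-cocycle is the
   class of E.

   Conversely, such operators on a pre-Lie algebra M containing V as a central
   invariant subspace, for which the coboundary of the defect is a V-valued
   map t, make (M / V) ⊕ g a pre-Lie algebra and M -> (M / V) ⊕ g -> g a
   crossed module extension of class t. Two consequences follow.
   - If E and E' have the same class, then M = m × m' with V embedded
     diagonally gives an extension that maps to both E and E'.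
   - If t is the coboundary of a 2-cochain with values in a representation
     W ⊃ V, then M = W with the zero product gives an extension of class t.

   Every cocycle becomes a coboundary in W = Hom(S(g), V), where x in g acts on
   the symmetric algebra S(g) by P |-> x P + D_x(P), with D_x the derivation
   extending y |-> x ∘ y: these operators represent the Lie algebra of g
   because [D_x, D_y] = D_[x,y] and D_x y - D_y x = [x, y]. The cochain is
   found degree by degree by the exactness of the Koszul complex, which in
   positive characteristic requires an ordered basis of g. *)

Set Implicit Arguments.
Unset Strict Implicit.
Unset Printing Implicit Defensive.

Import GRing.Theory.
Local Open Scope ring_scope.

(** * Abelian groups and linear algebra *)

Section Abel.
Variable V : zmodType.

Inductive zexp := ZVar of nat | Zero | ZAdd of zexp & zexp | ZOpp of zexp.

Fixpoint zeval (e : seq V) (t : zexp) : V :=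
  match t with
  | ZVar n => nth 0 e n
  | Zero => 0
  | ZAdd a b => zeval e a + zeval e b
  | ZOpp a => - zeval e a
  end.

Fixpoint zflat (t : zexp) : seq nat * seq nat :=
  match t with
  | ZVar n => ([:: n], [::])
  | Zero => ([::], [::])
  | ZAdd a b => ((zflat a).1 ++ (zflat b).1, (zflat a).2 ++ (zflat b).2)
  | ZOpp a => ((zflat a).2, (zflat a).1)
  end.

Lemma zflatE e t : zeval e t =
  \sum_(i <- (zflat t).1) nth 0 e i - \sum_(i <- (zflat t).2) nth 0 e i.
Proof.
elim: t => [n||a IHa b IHb|a IHa] /=.
- by rewrite big_seq1 big_nil subr0.
- by rewrite !big_nil subr0.
- by rewrite IHa IHb !big_cat /= opprD addrACA.
- by rewrite IHa opprB.
Qed.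

Lemma zflat_sound e a b :
  perm_eq ((zflat a).1 ++ (zflat b).2) ((zflat b).1 ++ (zflat a).2) ->
  zeval e a = zeval e b.
Proof.
move=> /(perm_big _ (op := +%R) (F := nth 0 e)) /= H.
rewrite !zflatE; apply/eqP; rewrite subr_eq addrAC eq_sym subr_eq.
by rewrite -!big_cat H.
Qed.

End Abel.

(* Identities of abelian groups: both sides are flattened into the lists of
   their positive and negative atoms, which are compared up to permutation. *)
(* Atoms are compared up to types and to the implicit structures of scalings
   and of linear maps, which depend on the path by which a term was reached. *)
Ltac abel_same x y :=
  first [ constr_eq x y
  | lazymatch type of x with Type => unify x y end
  | lazymatch x with
    | @GRing.scale _ _ ?c ?u =>
        lazymatch y with @GRing.scale _ _ c ?v => abel_same u v end
    | @GRing.Linear.sort _ _ _ _ ?f ?u =>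
        lazymatch y with @GRing.Linear.sort _ _ _ _ f ?v => abel_same u v end
    | (fun a => @?f a) => unify x y
    | ?f ?u => lazymatch y with ?h ?v => abel_same f h; abel_same u v end
    end ].
Ltac abel_index x env :=
  lazymatch env with
  | cons ?y ?env' =>
    match env with
    | _ => let _ := match env with _ => abel_same x y end in constr:(O)
    | _ => let n := abel_index x env' in constr:(S n)
    end
  end.
Ltac abel_atoms e env :=
  lazymatch e with
  | @Algebra.add _ ?x ?y =>
      let env' := abel_atoms x env in abel_atoms y env'
  | @Algebra.opp _ ?x => abel_atoms x env
  | @Algebra.zero _ => env
  | _ => match env with
         | _ => let n := abel_index e env in env
         | _ => constr:(cons e env)
         end
  end.
Ltac abel_reify e env :=
  lazymatch e with
  | @Algebra.add _ ?x ?y =>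
      let a := abel_reify x env in let b := abel_reify y env in
      constr:(ZAdd a b)
  | @Algebra.opp _ ?x => let a := abel_reify x env in constr:(ZOpp a)
  | @Algebra.zero _ => constr:(Zero)
  | _ => let n := abel_index e env in constr:(ZVar n)
  end.
Ltac abel :=
  lazymatch goal with
  | |- @eq _ ?a ?b =>
    let V := constr:((fun (V : zmodType) (x : V) => V) _ a) in
    let V := eval cbv beta in V in
    let env0 := constr:(@nil (Algebra.Zmodule.sort V)) in
    let env1 := abel_atoms a env0 in
    let env := abel_atoms b env1 in
    let ta := abel_reify a env in
    let tb := abel_reify b env in
    change (@zeval V env ta = @zeval V env tb);
    apply: zflat_sound; vm_compute; reflexivity
  end.

(** * Linear and bilinear maps as bare functions, without bundled structures *)

Section RawLinear.
Variable k : fieldType.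
Implicit Types U V W : lmodType k.

Section OneArgument.
Variables (U V : lmodType k) (f : U -> V).
Hypothesis Hf : linear f.

Lemma lin0 : f 0 = 0.
Proof. by have := Hf (-1) 0 0; rewrite scaler0 addr0 scaleN1r addNr. Qed.

Lemma linZ c u : f (c *: u) = c *: f u.
Proof. by have := Hf c u 0; rewrite lin0 !addr0. Qed.

Lemma linD u v : f (u + v) = f u + f v.
Proof. by rewrite -[u in LHS]scale1r Hf scale1r. Qed.

Lemma linN u : f (- u) = - f u.
Proof. by rewrite -scaleN1r linZ scaleN1r. Qed.

Definition lin_pack : {linear U -> V} :=
  HB.pack f (GRing.isLinear.Build k U V _ f Hf).

End OneArgument.

Definition bilin U V W (f : U -> V -> W) : Prop :=
  (forall v, linear (f^~ v)) /\ (forall u, linear (f u)).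

Section TwoArguments.
Variables (U V W : lmodType k) (f : U -> V -> W).
Hypothesis Hf : bilin f.

Lemma bil0l v : f 0 v = 0. Proof. exact: (lin0 (Hf.1 v)). Qed.
Lemma bil0r u : f u 0 = 0. Proof. exact: (lin0 (Hf.2 u)). Qed.
Lemma bilZl c u v : f (c *: u) v = c *: f u v.
Proof. exact: (linZ (Hf.1 v)). Qed.
Lemma bilZr c u v : f u (c *: v) = c *: f u v.
Proof. exact: (linZ (Hf.2 u)). Qed.
Lemma bilDl u u' v : f (u + u') v = f u v + f u' v.
Proof. exact: (linD (Hf.1 v)). Qed.
Lemma bilDr u v v' : f u (v + v') = f u v + f u v'.
Proof. exact: (linD (Hf.2 u)). Qed.
Lemma bilNl u v : f (- u) v = - f u v.
Proof. exact: (linN (Hf.1 v)). Qed.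
Lemma bilNr u v : f u (- v) = - f u v.
Proof. exact: (linN (Hf.2 u)). Qed.

Definition bilE :=
  (bilDl, bilDr, bilNl, bilNr, bilZl, bilZr, bil0l, bil0r).

End TwoArguments.

Lemma bilin_circ (g : preLieType k) : bilin (@circ k g).
Proof. by split; [apply: circ_linearl | apply: circ_linearr]. Qed.

Section Representation.
Variables (g : preLieType k) (V : lmodType k) (rV : representation g V).

Lemma bilin_lact : bilin (lact rV).
Proof. by split; [apply: lact_linearl | apply: lact_linearr]. Qed.

Lemma bilin_ract : bilin (ract rV).
Proof. by split=> v; [apply: ract_linearl | apply: ract_linearr]. Qed.

End Representation.

End RawLinear.

(** * A well-ordered basis of a complement of a subspace *)

Section RelativeBasis.
Variables (k : fieldType) (B : lmodType k) (D : B -> Prop).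
Hypotheses (D0 : D 0) (DP : forall c u v, D u -> D v -> D (c *: u + v)).

(** An arbitrary well-order of the whole space, unrelated to its linear structure. It selects the
    basis below and later orders the letters of monomials in the Koszul contraction. *)
Definition bleq : rel B := sval (well_ordering_principle B).

Lemma bleq_wo : well_order bleq.
Proof. exact: svalP (well_ordering_principle B). Qed.

Lemma bleq_wo_chain : wo_chain bleq predT.
Proof. by move=> A _; apply: bleq_wo. Qed.

Lemma bleq_anti : antisymmetric bleq.
Proof. by move=> x y; apply: (wo_chain_antisymmetric bleq_wo_chain). Qed.

Lemma bleq_total : total bleq.
Proof. by move=> x y; apply: (wo_chainW bleq_wo_chain). Qed.

Lemma bleq_refl : reflexive bleq.
Proof. by move=> x; apply: (wo_chain_reflexive bleq_wo_chain). Qed.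

Lemma bleq_min (P : B -> Prop) x :
  P x -> exists2 z, P z & forall y, P y -> bleq z y.
Proof.
move=> Px; have [|z [[zP zmin] _]] := bleq_wo (A := [pred y | `[<P y>]]).
  by exists x; apply/asboolP.
exists z; first exact/asboolP.
by move=> y Py; apply: zmin; apply/asboolP.
Qed.

(** The three elements have a minimum. If it is not [x], antisymmetry identifies two of them and the
    claim becomes one of the known inequalities. *)
Lemma bleq_trans : transitive bleq.
Proof.
move=> y x z xy yz.
have [|w wP wmin] := @bleq_min (fun w => [\/ w = x, w = y | w = z]) x.
  by constructor.
have wx : bleq w x by apply: wmin; constructor.
have wy : bleq w y by apply: wmin; constructor.
have wz : bleq w z by apply: wmin; constructor.
case: wP => E; rewrite E in wx wy wz => //.
  by rewrite (_ : x = y) //; apply: bleq_anti; rewrite xy.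
rewrite (_ : z = y) //; apply: bleq_anti; by rewrite wy.
Qed.

(** Formal combinations are lists of coefficient-vector pairs in which a vector may occur several
    times. *)
Definition comb (M : lmodType k) (f : B -> M) (s : seq (k * B)) : M :=
  \sum_(p <- s) p.1 *: f p.2.

Definition below (x : B) : Prop := exists d s,
  [/\ D d, forall p, p \in s -> p.2 != x /\ bleq p.2 x & x = d + comb id s].

(* The elements outside of the span of D and of the elements before them: a
   basis of a complement of D. *)
Definition rel_basis (x : B) : Prop := ~ below x.

(** The spanning property as an induction principle. A minimal counterexample is not a basis
    element, hence is a combination of an element of [D] and of smaller vectors, which all satisfy
    [P]. *)
Lemma rel_basis_ind (P : B -> Prop) :
  (forall x, D x -> P x) -> (forall x, rel_basis x -> P x) ->
  (forall c u v, P u -> P v -> P (c *: u + v)) -> forall x, P x.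
Proof.
move=> PD PI PL x; apply: contrapT => nPx.
have [z nPz zmin] := bleq_min (P := fun x => ~ P x) nPx.
apply: nPz; case: (EM (below z)) => [[d [s [Dd sP ->]]]|]; last exact: PI.
have {}sP p : p \in s -> P p.2.
  move=> ps; have [pz zp] := sP _ ps; apply: contrapT => /zmin zq.
  by case/eqP: pz; apply: bleq_anti; rewrite zp.
rewrite addrC /comb; elim: s sP => [|p s IHs] sP.
  by rewrite big_nil add0r; apply: PD.
rewrite big_cons -addrA; apply: PL; first by apply: sP; rewrite mem_head.
by apply: IHs => q qs; apply: sP; rewrite inE qs orbT.
Qed.

Lemma comb_cat (M : lmodType k) (f : B -> M) s t :
  comb f (s ++ t) = comb f s + comb f t.
Proof. by rewrite /comb big_cat. Qed.

Lemma comb_scale (M : lmodType k) (f : B -> M) c s :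
  comb f [seq (c * p.1, p.2) | p <- s] = c *: comb f s.
Proof.
by rewrite /comb big_map scaler_sumr; apply: eq_bigr => p _; rewrite scalerA.
Qed.

Lemma seq_max (s : seq (k * B)) : s != [::] ->
  exists2 p, p \in s & forall q, q \in s -> bleq q.2 p.2.
Proof.
elim: s => // a [|b s] IHs _.
  exists a; rewrite ?mem_head // => q.
  by rewrite inE => /eqP->; apply: bleq_refl.
have [//|p ps pP] := IHs; have [ap|pa] := orP (bleq_total a.2 p.2).
  exists p; first by rewrite inE ps orbT.
  by move=> q; rewrite inE => /predU1P[->|/pP].
exists a; first by rewrite mem_head.
move=> q; rewrite inE => /predU1P[->|/pP qp]; first exact: bleq_refl.
exact: bleq_trans pa.
Qed.

Section Extend.
Variables (M : lmodType k) (f0 f : B -> M).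
Hypothesis f0L : forall c u v, D u -> D v -> f0 (c *: u + v) = c *: f0 u + f0 v.

Let f00 : f0 0 = 0.
Proof.
have := f0L (-1) D0 D0.
by rewrite scaler0 addr0 scaleN1r addNr.
Qed.

Lemma rel_basis_free d s : D d -> (forall p, p \in s -> rel_basis p.2) ->
  d + comb id s = 0 -> f0 d + comb f s = 0.
Proof.
move=> Dd; have [n] := ubnP (size s); elim: n s => // n IHn s.
have [->|s0] := eqVneq s [::].
  by move=> _ _; rewrite /comb !big_nil !addr0 => ->.
have [m ms mmax] := seq_max s0; move=> ssz sI.
pose s' := [seq p <- s | p.2 != m.2].
(* The occurrences of [m.2] in [s] are collected into one coefficient. *)
pose C : k := \sum_(p <- s | p.2 == m.2) p.1.
have split_comb (N : lmodType k) (h : B -> N) :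
    comb h s = C *: h m.2 + comb h s'.
  rewrite /comb (bigID (fun p : k * B => p.2 == m.2)) /= big_filter.
  congr (_ + _).
  by rewrite scaler_suml; apply: eq_bigr => p /eqP->.
have s'sz : (size s' < n)%N.
  rewrite -ltnS; apply: leq_trans ssz; rewrite size_filter ltnS.
  rewrite -(count_predC (fun p : k * B => p.2 != m.2) s).
  rewrite -addn1 leq_add2l -has_count; apply/hasP; exists m => //=.
  by rewrite eqxx.
have s'I p : p \in s' -> rel_basis p.2.
  by rewrite mem_filter => /andP[_ /sI].
rewrite !split_comb => H.
suff C0 : C = 0.
  by move: H; rewrite C0 !scale0r !add0r; apply: IHn.
apply/eqP/negP => /negP C0; apply: (sI m ms).
(* The summand 0 gives the witness the shape required by [DP]. *)
exists ((- C^-1) *: d + 0), [seq (- C^-1 * p.1, p.2) | p <- s']; split.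
- exact: DP.
- move=> _ /mapP[p + ->] /=; rewrite mem_filter => /andP[-> ps].
  by split=> //; apply: mmax.
rewrite comb_scale addr0 -scalerDr.
have -> : d + comb id s' = - (C *: m.2).
  by apply/eqP; rewrite -addr_eq0 -addrA [_ + C *: _]addrC H.
by rewrite scalerN scaleNr opprK scalerA mulVf // scale1r.
Qed.

(** The graph [G] of the extension is linear by construction, single-valued by [rel_basis_free] and
    total by [rel_basis_ind]. *)
Lemma rel_basis_extend : exists F : B -> M,
  [/\ linear F, forall d, D d -> F d = f0 d
    & forall x, rel_basis x -> F x = f x].
Proof.
pose G x a := exists d s, [/\ D d, forall p, p \in s -> rel_basis p.2,
  x = d + comb id s & a = f0 d + comb f s].
have GL c x a y b : G x a -> G y b -> G (c *: x + y) (c *: a + b).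
  move=> [d [s [Dd sI -> ->]]] [e [t [De tI -> ->]]].
  exists (c *: d + e), ([seq (c * p.1, p.2) | p <- s] ++ t); split.
  - exact: DP.
  - by move=> p; rewrite mem_cat => /orP[/mapP[q /sI ? ->]|/tI].
  - by rewrite comb_cat comb_scale scalerDr addrACA.
  - by rewrite comb_cat comb_scale f0L // scalerDr addrACA.
have G0 a : G 0 a -> a = 0.
  by move=> [d [s [Dd sI /esym H ->]]]; apply: rel_basis_free.
have GU x a b : G x a -> G x b -> a = b.
  move=> Ga Gb; have := GL (-1) _ _ _ _ Gb Ga.
  by rewrite !scaleN1r addNr => /G0/eqP; rewrite addrC subr_eq0 => /eqP.
have Gd d : D d -> G d (f0 d).
  by move=> Dd; exists d, [::]; rewrite /comb !big_nil !addr0.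
have Gf x : rel_basis x -> G x (f x).
  move=> Ix; exists 0, [:: (1, x)]; rewrite /comb !big_seq1 !scale1r f00 !add0r.
  by split=> // p; rewrite inE => /eqP->.
have Gtot : forall x, exists a, G x a.
  apply: rel_basis_ind => [x /Gd|x /Gf|c u v [a Ga] [b Gb]].
  - by exists (f0 x).
  - by exists (f x).
  - by exists (c *: a + b); apply: GL.
have [F FP] := choice Gtot; exists F; split.
- by move=> c u v; apply: GU (FP _) _; apply: GL.
- by move=> d /Gd; apply: GU.
- by move=> d /Gf; apply: GU.
Qed.

End Extend.
End RelativeBasis.

(** * Linear sections, retractions and bilinear lifts *)

Section LinearChoice.
Variable k : fieldType.

Definition trivial_sub (B : lmodType k) (x : B) : Prop := x = 0.

Lemma trivial_subP (B : lmodType k) c (u v : B) :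
  trivial_sub u -> trivial_sub v -> trivial_sub (c *: u + v).
Proof. by move=> -> ->; rewrite /trivial_sub scaler0 addr0. Qed.

Definition basis (B : lmodType k) : B -> Prop := rel_basis (@trivial_sub B).

Lemma basis_extend (B M : lmodType k) (f : B -> M) :
  exists2 F : B -> M, linear F & forall x, basis x -> F x = f x.
Proof.
have [|F [FL _ FP]] := rel_basis_extend (erefl : @trivial_sub B 0)
  (@trivial_subP B) (f0 := fun=> 0 : M) f.
  by move=> *; rewrite scaler0 addr0.
by exists F.
Qed.

Lemma basis_ind (B : lmodType k) (P : B -> Prop) : P 0 ->
  (forall x, basis x -> P x) ->
  (forall c u v, P u -> P v -> P (c *: u + v)) -> forall x, P x.
Proof. by move=> P0; apply: rel_basis_ind => x ->. Qed.

Lemma basis_eq (B M : lmodType k) (F G : B -> M) : linear F -> linear G ->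
  (forall x, basis x -> F x = G x) -> F =1 G.
Proof.
move=> FL GL FG; apply: basis_ind => [|//|c u v Hu Hv].
- by rewrite (lin0 FL) (lin0 GL).
- by rewrite FL GL Hu Hv.
Qed.

(** Values are chosen on a basis and extended linearly. All linear sections used below come from
    this statement. *)
Lemma linear_choice (B A : lmodType k) (G : B -> A -> Prop) :
  (forall c x a y b, G x a -> G y b -> G (c *: x + y) (c *: a + b)) ->
  (forall x, exists a, G x a) ->
  exists2 F : B -> A, linear F & forall x, G x (F x).
Proof.
move=> GL Gtot; have [f fP] := choice Gtot.
have [F FL FP] := basis_extend f.
exists F => //; apply: basis_ind => [|x Ix|c u v Hu Hv].
(* Subtracting [G 0 (f 0)] from itself gives [G 0 0]. *)
- rewrite (lin0 FL); have := GL (-1) _ _ _ _ (fP 0) (fP 0).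
  by rewrite !scaleN1r !addNr.
- by rewrite FP.
- by rewrite FL; apply: GL.
Qed.

(** The inverse of [j] on its image is extended by zero on a basis of a complement. *)
Lemma linear_retraction (V M : lmodType k) (j : V -> M) :
  linear j -> injective j -> exists2 t : M -> V, linear t & cancel j t.
Proof.
move=> jL jI; pose D u := exists v, u = j v.
have D0 : D 0 by exists 0; rewrite (lin0 jL).
have DP c u v : D u -> D v -> D (c *: u + v).
  by move=> [a ->] [b ->]; exists (c *: a + b); rewrite jL.
have [f fP] : exists f : M -> V, cancel j f.
  have /choice[f fP] : forall u, exists v, D u -> u = j v.
    by move=> u; case: (EM (D u)) => [[v ->]|?]; [exists v|exists 0].
  by exists f => v; apply: jI; rewrite -fP //; exists v.
have [|F [FL FD _]] := rel_basis_extend D0 DP (f0 := f) (fun=> 0).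
  by move=> c _ _ [a ->] [b ->]; rewrite -jL !fP.
by exists F => // v; rewrite FD ?fP //; exists v.
Qed.

(** [linear_choice] is applied twice: for a fixed first argument, to lift linearly in the second,
    and then to choose these lifts linearly in the space of functions [C -> M]. *)
Lemma bilinear_lift (B C M N : lmodType k) (mu : M -> N) (f : B -> C -> N) :
  linear mu -> bilin f -> (forall x y, exists u, mu u = f x y) ->
  exists2 s : B -> C -> M, bilin s & forall x y, mu (s x y) = f x y.
Proof.
move=> muL fL H.
pose G x (h : C -> M) := linear h /\ forall y, mu (h y) = f x y.
have [|x|s sL sP] := @linear_choice B (C -> M) G.
- move=> c x a y b [aL aP] [bL bP].
  have E z : (c *: a + b) z = c *: a z + b z by [].
  split=> [e u v|z]; last by rewrite E muL aP bP !(bilE fL).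
  by rewrite !E aL bL !scalerDr !scalerA (mulrC c e) addrACA.
- have GL c y a z b : mu a = f x y -> mu b = f x z ->
      mu (c *: a + b) = f x (c *: y + z).
    by move=> Ha Hb; rewrite muL Ha Hb !(bilE fL).
  have [h hL hP] := linear_choice GL (H x).
  by exists h.
exists s; last by move=> x y; apply: (sP x).2.
by split=> [y c u v|x]; [rewrite sL|apply: (sP x).1].
Qed.

End LinearChoice.

(** * Actions up to a defect *)

Section Coboundaries.
Variables (k : fieldType) (g : preLieType k) (M : lmodType k).
Variables (l : g -> M -> M) (r : M -> g -> M).

(** The coboundaries from C^2 and, in [cob3], from C^3, written for arbitrary operators so that they
    also make sense for those coming from a mere section; see [d_vec2] and [d_vec3]. *)
Definition cob2 (s : g -> g -> M) (x y z : g) : M :=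
  l x (s y z) - l y (s x z) + r (s y x) z - r (s x y) z
  - s y (x ∘ z) + s x (y ∘ z) - s (bracket x y) z.

Definition cob3 (t : g -> g -> g -> M) (x y z w : g) : M :=
  l x (t y z w) - l y (t x z w) + l z (t x y w)
  + r (t y z x) w - r (t x z y) w + r (t x y z) w
  - t y z (x ∘ w) + t x z (y ∘ w) - t x y (z ∘ w)
  - t (bracket x y) z w + t (bracket x z) y w - t (bracket y z) x w.

End Coboundaries.

(** The pre-Lie identity oriented as a rewriting rule, which brings expressions to a form where
    [abel] can conclude. *)
Lemma circ_swap (k : fieldType) (g : preLieType k) (x y z : g) :
  x ∘ (y ∘ z) = y ∘ (x ∘ z) + x ∘ y ∘ z - y ∘ x ∘ z.
Proof.
have /eqP := circ_preLie x y z; rewrite subr_eq => /eqP->.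
by abel.
Qed.

(* A pair of linear sections in a crossed module extension makes g act on m
   only up to the inner operators of the values of the bilinear map [defect]:
   these are the laws that remain. *)
Record weak_action (k : fieldType) (g M : preLieType k) := WeakAction {
  wl : g -> M -> M;
  wr : M -> g -> M;
  defect : g -> g -> M;
  wl_bilin : bilin wl;
  wr_bilin : bilin wr;
  defect_bilin : bilin defect;
  wl_bracket : forall x y u, wl x (wl y u) =
    wl y (wl x u) + wl (bracket x y) u + (defect x y - defect y x) ∘ u;
  wr_wl : forall x y u, wr (wl x u) y =
    wl x (wr u y) + wr (wr u x) y - wr u (x ∘ y) - u ∘ defect x y;
  wl_circ : forall x u v, wl x (u ∘ v) =
    wl x u ∘ v - wr u x ∘ v + u ∘ wl x v;
  wr_circ : forall x u v, wr (u ∘ v) x =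
    u ∘ wr v x + wr (v ∘ u) x - v ∘ wr u x
}.

Section WeakAction.
Variables (k : fieldType) (g M : preLieType k) (A : weak_action g M).

Let lE := bilE (wl_bilin A).
Let rE := bilE (wr_bilin A).
Let sE := bilE (defect_bilin A).
Let gE := bilE (bilin_circ g).
Let mE := bilE (bilin_circ M).

(** The operators do not form a representation, but their failure is measured by the defect itself:
    the products of two defect values that appear cancel. *)
Lemma cob3_cob2 x y z w :
  cob3 (wl A) (wr A) (cob2 (wl A) (wr A) (defect A)) x y z w = 0.
Proof.
have brE (a b : g) : bracket a b = a ∘ b - b ∘ a by [].
rewrite /cob3 /cob2 !brE.
rewrite !(lE, rE, sE, gE, mE).
rewrite !(wl_bracket A x y) !(wl_bracket A x z) !(wl_bracket A y z) !wr_wl !brE.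
rewrite !(circ_swap x y) !(circ_swap x z) !(circ_swap y z).
rewrite !(lE, rE, sE, gE, mE).
by abel.
Qed.

Section ChangeOfSection.
Variables (lam : g -> M) (lamL : linear lam).

(** In an extension, these are the data of the section obtained by adding mu ∘ [lam]: by the Peiffer
    identities mu([lam x]) acts as multiplication by [lam x]. *)
Definition shift_wl x u := wl A x u + lam x ∘ u.
Definition shift_wr u x := wr A u x + u ∘ lam x.
Definition shift_defect x y :=
  defect A x y + wl A x (lam y) + wr A (lam x) y + lam x ∘ lam y - lam (x ∘ y).

Lemma cob2_shift x y z : cob2 shift_wl shift_wr shift_defect x y z =
  cob2 (wl A) (wr A) (defect A) x y z.
Proof.
rewrite /cob2 /shift_wl /shift_wr /shift_defect /bracket.
rewrite !(lE, rE, sE, gE, mE, linD lamL, linN lamL).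
rewrite !(wl_bracket A x y) !wr_wl !wl_circ !(wr_circ _ z (lam x) (lam y)).
rewrite /bracket.
rewrite !(circ_swap x y) !(circ_swap (lam x) (lam y)).
rewrite !(lE, rE, sE, gE, mE, linD lamL, linN lamL).
by abel.
Qed.

End ChangeOfSection.
End WeakAction.

(** * The extension attached to an action with a defect *)

Record crossed_datum (k : fieldType) (g : preLieType k) (V : lmodType k)
    (rV : representation g V) := CrossedDatum {
  cd_m : preLieType k;
  cd_act : weak_action g cd_m;
  cd_j : V -> cd_m;
  cd_class : g -> g -> g -> V;
  cd_jL : linear cd_j;
  cd_jI : injective cd_j;
  cd_jl : forall v u, cd_j v ∘ u = 0;
  cd_jr : forall v u, u ∘ cd_j v = 0;
  cd_wl : forall x v, wl cd_act x (cd_j v) = cd_j (lact rV x v);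
  cd_wr : forall x v, wr cd_act (cd_j v) x = cd_j (ract rV v x);
  cd_classE : forall x y z,
    cob2 (wl cd_act) (wr cd_act) (defect cd_act) x y z
    = cd_j (cd_class x y z)
}.

Section Realization.
Variables (k : fieldType) (g : preLieType k) (V : lmodType k).
Variables (rV : representation g V) (D : crossed_datum rV).

Notation M := (cd_m D).
Notation A := (cd_act D).
Notation j := (cd_j D).

Definition cd_ret : M -> V :=
  s2val (cid2 (linear_retraction (@cd_jL _ _ _ _ D) (@cd_jI _ _ _ _ D))).

Lemma cd_ret_linear : linear cd_ret.
Proof. by rewrite /cd_ret; case: cid2. Qed.

Lemma cd_jK : cancel j cd_ret.
Proof. by rewrite /cd_ret; case: cid2. Qed.

Definition ker_ret : {pred M} := [pred u | cd_ret u == 0].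

Fact ker_ret_submod : submod_closed ker_ret.
Proof.
split=> [|c u v]; rewrite !inE ?(lin0 cd_ret_linear) //.
by rewrite cd_ret_linear => /eqP-> /eqP->; rewrite scaler0 addr0.
Qed.

HB.instance Definition _ :=
  GRing.isSubmodClosed.Build k M ker_ret ker_ret_submod.

(* The quotient M / V, as a complement of V in M. *)
Definition cd_quo : Type := {u : M | u \in ker_ret}.

HB.instance Definition _ := SubType.on cd_quo.
HB.instance Definition _ := [Choice of cd_quo by <:].
HB.instance Definition _ := [SubChoice_isSubLmodule of cd_quo by <:].

Lemma cd_proj_subproof u : u - j (cd_ret u) \in ker_ret.
Proof.
rewrite inE (linD cd_ret_linear) (linN cd_ret_linear) cd_jK subrr.
exact: eqxx.
Qed.

Definition cd_proj (u : M) : cd_quo :=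
  exist (fun u => u \in ker_ret) _ (cd_proj_subproof u).
Definition cd_val (q : cd_quo) : M := val q.

Lemma cd_val_linear : linear cd_val.
Proof. by move=> c u v; rewrite /cd_val linearP. Qed.

Lemma cd_valE u : cd_val (cd_proj u) = u - j (cd_ret u).
Proof. by []. Qed.

Lemma cd_proj_linear : linear cd_proj.
Proof.
move=> c u v; apply: val_inj; rewrite linearP /=.
rewrite cd_ret_linear (linD (@cd_jL _ _ _ _ D)) (linZ (@cd_jL _ _ _ _ D)).
by rewrite scalerBr opprD addrACA.
Qed.

Lemma cd_valK q : cd_proj (cd_val q) = q.
Proof.
apply: val_inj; rewrite /= (eqP (valP q)) (lin0 (@cd_jL _ _ _ _ D)).
by rewrite subr0.
Qed.

Lemma cd_proj0P u : cd_proj u = 0 <-> exists v, u = j v.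
Proof.
split=> [/(congr1 cd_val)|[v ->]].
  rewrite cd_valE (lin0 cd_val_linear) => /eqP; rewrite subr_eq0 => /eqP->.
  by exists (cd_ret u).
by apply: val_inj; rewrite /= cd_jK subrr.
Qed.

Lemma cd_projDj u v : cd_proj (u + j v) = cd_proj u.
Proof.
rewrite (linD cd_proj_linear) (_ : cd_proj (j v) = 0) ?addr0 //.
by apply/cd_proj0P; exists v.
Qed.

Definition cd_ext : Type := (cd_quo * g)%type.

HB.instance Definition _ := GRing.Lmodule.on cd_ext.

(** The M-component of the product on M ⊕ g before V is divided out. The pre-Lie identity then holds
    only up to [cd_class], an error that [cd_proj] kills. *)
Definition cd_mul (p q : M * g) : M :=
  p.1 ∘ q.1 + wl A p.2 q.1 + wr A p.1 q.2 + defect A p.2 q.2.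

Definition cd_circ (p q : cd_ext) : cd_ext :=
  (cd_proj (cd_mul (cd_val p.1, p.2) (cd_val q.1, q.2)), p.2 ∘ q.2).

Let lE := bilE (wl_bilin A).
Let rE := bilE (wr_bilin A).
Let sE := bilE (defect_bilin A).
Let gE := bilE (bilin_circ g).
Let mE := bilE (bilin_circ M).

Let pairP c (p q : M * g) : ((c *: p + q).1 = c *: p.1 + q.1) *
  ((c *: p + q).2 = c *: p.2 + q.2).
Proof. by []. Qed.

Lemma cd_mul_linearl q : linear (cd_mul^~ q).
Proof.
move=> c p p'; rewrite /cd_mul !pairP !(lE, rE, sE, mE) !scalerDr.
by abel.
Qed.

Lemma cd_mul_linearr p : linear (cd_mul p).
Proof.
move=> c q q'; rewrite /cd_mul !pairP !(lE, rE, sE, mE) !scalerDr.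
by abel.
Qed.

Lemma cd_circ_linearl q : linear (cd_circ^~ q).
Proof.
move=> c p p'; congr pair; last exact: (bilin_circ g).1.
by rewrite -cd_proj_linear -cd_mul_linearl; congr (cd_proj (cd_mul _ _)).
Qed.

Lemma cd_circ_linearr p : linear (cd_circ p).
Proof.
move=> c q q'; congr pair; last exact: (bilin_circ g).2.
by rewrite -cd_proj_linear -cd_mul_linearr; congr (cd_proj (cd_mul _ _)).
Qed.

(** The representative differs from [u] by an element of V. As V annihilates M and is stable under
    the operators of g, the product changes by an element of V. *)
Lemma cd_mul_projl u x q :
  cd_proj (cd_mul (cd_val (cd_proj u), x) q) = cd_proj (cd_mul (u, x) q).
Proof.
rewrite -[in RHS](cd_projDj _ (- ract rV (cd_ret u) q.2)); congr cd_proj.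
rewrite /cd_mul /= cd_valE !(mE, rE) cd_jl cd_wr (linN (@cd_jL _ _ _ _ D)).
by abel.
Qed.

Lemma cd_mul_projr p u x :
  cd_proj (cd_mul p (cd_val (cd_proj u), x)) = cd_proj (cd_mul p (u, x)).
Proof.
rewrite -[in RHS](cd_projDj _ (- lact rV p.2 (cd_ret u))); congr cd_proj.
rewrite /cd_mul /= cd_valE !(mE, lE) cd_jr cd_wl (linN (@cd_jL _ _ _ _ D)).
by abel.
Qed.

(** The laws of the weak action cancel every term involving a component in M; the terms with all
    three arguments in g add up to the coboundary of the defect. *)
Lemma cd_mul_preLie p q s :
  cd_mul (cd_mul p q, p.2 ∘ q.2) s - cd_mul p (cd_mul q s, q.2 ∘ s.2)
  + j (cd_class D p.2 q.2 s.2) =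
  cd_mul (cd_mul q p, q.2 ∘ p.2) s - cd_mul q (cd_mul p s, p.2 ∘ s.2).
Proof.
case: p q s => [a x] [b y] [c z].
rewrite /= -cd_classE /cob2 /cd_mul /bracket /=.
rewrite !(lE, rE, sE, mE, gE).
rewrite !(wl_bracket A x y) !wr_wl !wl_circ !(wr_circ _ z a b) /bracket.
rewrite !(circ_swap a b).
rewrite !(lE, rE, sE, mE, gE).
by abel.
Qed.

Lemma cd_circ_preLie p q s :
  cd_circ (cd_circ p q) s - cd_circ p (cd_circ q s) =
  cd_circ (cd_circ q p) s - cd_circ q (cd_circ p s).
Proof.
congr pair; last exact: circ_preLie.
rewrite /= !cd_mul_projl !cd_mul_projr -!(linN cd_proj_linear).
rewrite -!(linD cd_proj_linear) -(cd_mul_preLie (_, _) (_, _) (_, _)) /=.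
by rewrite cd_projDj.
Qed.

HB.instance Definition _ :=
  isPreLie.Build k cd_ext cd_circ_linearl cd_circ_linearr cd_circ_preLie.

(** The representative [cd_val] may be used here because V annihilates M. *)
Definition cd_lact (p : cd_ext) (u : M) : M := cd_val p.1 ∘ u + wl A p.2 u.
Definition cd_ract (u : M) (p : cd_ext) : M := u ∘ cd_val p.1 + wr A u p.2.

Lemma cd_lact_bilin : bilin cd_lact.
Proof.
split=> [u c p q|p c u v]; rewrite /cd_lact /=.
  by rewrite cd_val_linear !(lE, mE) scalerDr; abel.
by rewrite !(lE, mE) scalerDr; abel.
Qed.

Lemma cd_ract_bilin : bilin cd_ract.
Proof.
split=> [p c u v|u c p q]; rewrite /cd_ract /=.
  by rewrite !(rE, mE) scalerDr; abel.
by rewrite cd_val_linear !(rE, mE) scalerDr; abel.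
Qed.

Lemma cd_lact_bracket p q u : cd_lact (bracket p q) u =
  cd_lact p (cd_lact q u) - cd_lact q (cd_lact p u).
Proof.
rewrite (_ : bracket p q = p ∘ q - q ∘ p) // (bilE cd_lact_bilin).
rewrite (bilE cd_lact_bilin) /cd_lact /= !cd_valE /cd_mul /=.
move: (cd_val p.1) (cd_val q.1) => a b.
rewrite !(lE, mE) !cd_jl (wl_bracket A p.2) !wl_circ (circ_swap a b) /bracket.
rewrite !(lE, mE).
by abel.
Qed.

Lemma cd_lact_ract p q u :
  cd_ract (cd_lact p u) q - cd_lact p (cd_ract u q) =
  cd_ract (cd_ract u p) q - cd_ract u (p ∘ q).
Proof.
rewrite /cd_lact /cd_ract /= !cd_valE /cd_mul /=.
move: (cd_val p.1) (cd_val q.1) => a b.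
rewrite !(lE, rE, mE) !cd_jr !wl_circ !wr_wl (circ_swap a u) (wr_circ _ _ a u).
by abel.
Qed.

Definition cd_rep : representation cd_ext M :=
  Representation cd_lact_bilin.1 cd_lact_bilin.2
    cd_ract_bilin.1 cd_ract_bilin.2 cd_lact_bracket cd_lact_ract.

Lemma cd_lact_circ p u v :
  cd_lact p u ∘ v - cd_lact p (u ∘ v) = cd_ract u p ∘ v - u ∘ cd_lact p v.
Proof.
rewrite /cd_lact /cd_ract !mE wl_circ (circ_swap u).
by abel.
Qed.

Lemma cd_ract_circ p u v :
  cd_ract (u ∘ v) p - u ∘ cd_ract v p = cd_ract (v ∘ u) p - v ∘ cd_ract u p.
Proof.
rewrite /cd_ract !mE (wr_circ _ _ u v) (circ_swap u v).
by abel.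
Qed.

Definition cd_action : action cd_ext M :=
  @Action _ _ _ cd_rep cd_lact_circ cd_ract_circ.

Lemma cd_i_circ (u v : zero_preLie V) : j (u ∘ v) = j u ∘ j v.
Proof. by rewrite cd_jl; apply: (lin0 (@cd_jL _ _ _ _ D)). Qed.

Definition cd_i : preLie_hom (zero_preLie V) M :=
  @PreLieHom _ (zero_preLie V) M (lin_pack (@cd_jL _ _ _ _ D)) cd_i_circ.

Definition cd_mu_fun (u : M) : cd_ext := (cd_proj u, 0).

Lemma cd_mu_linear : linear cd_mu_fun.
Proof.
move=> c u v; congr pair; first exact: cd_proj_linear.
by change (0 = c *: (0 : g) + 0); rewrite scaler0 addr0.
Qed.

Lemma cd_mu_ract u p : cd_mu_fun (cd_ract u p) = cd_mu_fun u ∘ p.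
Proof.
congr pair; last by rewrite /= gE.
rewrite /= cd_mul_projl /cd_mul /= !(lE, sE) /cd_ract.
by congr cd_proj; abel.
Qed.

Lemma cd_mu_lact p u : cd_mu_fun (cd_lact p u) = p ∘ cd_mu_fun u.
Proof.
congr pair; last by rewrite /= gE.
rewrite /= cd_mul_projr /cd_mul /= !(rE, sE) /cd_lact.
by congr cd_proj; abel.
Qed.

Lemma cd_peiffer_l u v : cd_lact (cd_mu_fun u) v = u ∘ v.
Proof. by rewrite /cd_lact cd_valE !(lE, mE) cd_jl; abel. Qed.

Lemma cd_peiffer_r u v : cd_ract u (cd_mu_fun v) = u ∘ v.
Proof. by rewrite /cd_ract cd_valE !(rE, mE) cd_jr; abel. Qed.

Lemma cd_mu_circ u v : cd_mu_fun (u ∘ v) = cd_mu_fun u ∘ cd_mu_fun v.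
Proof. by rewrite -cd_mu_ract cd_peiffer_r. Qed.

Definition cd_mu : preLie_hom M cd_ext :=
  @PreLieHom _ M cd_ext (lin_pack cd_mu_linear) cd_mu_circ.

Lemma cd_pi_linear : linear (fun p : cd_ext => p.2).
Proof. by []. Qed.

Definition cd_pi : preLie_hom cd_ext g :=
  @PreLieHom _ cd_ext g (lin_pack cd_pi_linear) (fun p q => erefl).

Lemma cd_exactm u : cd_mu u = 0 <-> exists v, u = cd_i v.
Proof.
rewrite -(cd_proj0P u); split=> H; first exact: (congr1 fst H).
exact: (congr1 (fun q => (q, 0 : g)) H).
Qed.

Lemma cd_exactn (p : cd_ext) : cd_pi p = 0 <-> exists u, p = cd_mu u.
Proof.
case: p => q x; split=> [|[u [_ ->]] //] E; have {E} -> : x = 0 := E.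
exists (cd_val q); apply: (congr1 (fun q => (q, 0 : g))).
by rewrite cd_valK.
Qed.

Lemma cd_exactg z : exists p, cd_pi p = z.
Proof. by exists (0, z). Qed.

Definition cd_cm : is_crossed_module cd_action cd_mu :=
  @IsCrossedModule _ _ _ cd_action cd_mu (fun x u => cd_mu_ract u x)
    cd_mu_lact cd_peiffer_l cd_peiffer_r.

Definition realization : cm_extension g V :=
  @CMExtension _ _ _ M cd_ext cd_i cd_mu cd_pi cd_action
    (@cd_jI _ _ _ _ D) cd_exactm cd_exactn cd_exactg cd_cm.

End Realization.

(** * The class of an extension *)

Section LowDegreeCochains.
Variables (k : fieldType) (g : preLieType k) (V : lmodType k).
Variable rV : representation g V.

Definition vec1 (x : g) : 'I_1 -> g := fun=> x.
Definition vec2 (x y : g) : 'I_2 -> g := fun i => nth 0 [:: x; y] i.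
Definition vec3 (x y z : g) : 'I_3 -> g := fun i => nth 0 [:: x; y; z] i.

Lemma vec2_eta (x : 'I_2 -> g) : x = vec2 (x ord0) (x ord_max).
Proof.
apply/funext => i; rewrite /vec2.
case: i => [[|[|//]] H] /=; congr x; exact: val_inj.
Qed.

Lemma vec3_eta (x : 'I_3 -> g) : x = vec3 (x ord0) (x (inord 1)) (x ord_max).
Proof.
apply/funext => i; rewrite /vec3.
by case: i => [[|[|[|//]]] H] /=; congr x; apply: val_inj; rewrite //= inordK.
Qed.

Lemma del_vec2 (x y : g) (i : 'I_2) :
  del (vec2 x y) i = vec1 (nth 0 [:: y; x] i).
Proof.
apply/funext => j; rewrite /del /vec2 /vec1 (ord1 j).
by case: i => [[|[|//]] H].
Qed.

Lemma sum_ltn_mkcond n (i : nat) (F : 'I_n -> V) :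
  \sum_(j < n | (i < j)%N) F j = \sum_(j < n) if (i < j)%N then F j else 0.
Proof. exact: big_mkcond. Qed.

Lemma d_vec2 (h : ('I_1 -> g) -> g -> V) x y z : d rV h (vec2 x y) z =
  cob2 (lact rV) (ract rV) (fun a b => h (vec1 a) b) x y z.
Proof.
rewrite /d !big_ord_recl !big_ord0 /= !sum_ltn_mkcond /=.
rewrite !big_ord_recl !big_ord0 /=.
rewrite !del_vec2 /vec2 /bump /=.
rewrite (_ : del2_cons _ _ _ _ = vec1 (bracket x y)); last first.
  by apply/funext => i; rewrite (ord1 i).
rewrite !(expr0, expr1, scale1r, scaleN1r) /cob2.
by abel.
Qed.

Lemma del_vec3 (x y z : g) (i : 'I_3) :
  del (vec3 x y z) i =
  nth (vec2 0 0) [:: vec2 y z; vec2 x z; vec2 x y] i.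
Proof.
apply/funext => j; rewrite /del /vec2 /vec3.
by case: i => [[|[|[|//]]] H]; case: j => [[|[|//]] H'].
Qed.

(** The indices 0, 1, 2 add up to 3, so [3 - i - j] is the remaining one. *)
Lemma del2_cons_vec3 (a x y z : g) (i j : 'I_3) : (i < j)%N ->
  del2_cons a (vec3 x y z) i j = vec2 a (nth 0 [:: x; y; z] (3 - i - j)).
Proof.
move=> ij; apply/funext => l; rewrite /del2_cons /vec2 /vec3.
case: l => [[|[|//]] Hl] //=.
case: i ij => [[|[|[|//]]] Hi]; case: j => [[|[|[|//]]] Hj] //= _;
  by rewrite inordK.
Qed.

Lemma d_vec3 (f : ('I_2 -> g) -> g -> V) x y z w : d rV f (vec3 x y z) w =
  cob3 (lact rV) (ract rV) (fun a b c => f (vec2 a b) c) x y z w.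
Proof.
rewrite /d !big_ord_recl !big_ord0 /= !sum_ltn_mkcond /=.
rewrite !big_ord_recl !big_ord0 /=.
rewrite !del2_cons_vec3 // !del_vec3 /vec3 /bump /=.
rewrite !(expr0, expr1, exprSr, mul1r, mulN1r, opprK, scale1r, scaleN1r) /cob3.
by abel.
Qed.

Lemma cochain1_bilin (h : cochain g V 1) : bilin (fun a b => h (vec1 a) b).
Proof.
split=> [b c u v|a]; last exact: cochain_linear.
have updE a : upd (vec1 0) ord0 a = vec1 a.
  by apply/funext => i; rewrite /upd (ord1 i) eqxx.
by have := cochain_multilinear h (vec1 0) ord0 b c u v; rewrite /= !updE.
Qed.

Definition cochain1 (h : g -> g -> V) : bilin h -> cochain g V 1.
Proof.
move=> H; apply: (@Cochain _ _ _ _ (fun x y => h (x ord0) y)).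
- by move=> x; apply: H.2.
- by move=> x i y c u v; rewrite /upd (ord1 i) eqxx; apply: H.1.
- by move=> x i j; rewrite (ord1 i) (ord1 j).
Defined.

Record alternating3 (t : g -> g -> g -> V) : Prop := Alternating3 {
  alt3_1 : forall y z, linear (fun x => t x y z);
  alt3_2 : forall x z, linear (fun y => t x y z);
  alt3_3 : forall x y, linear (t x y);
  alt3_alt : forall x z, t x x z = 0
}.

Definition fun3 (f : cochain g V 2) (x y z : g) : V := f (vec2 x y) z.

Lemma fun3_alternating f : alternating3 (fun3 f).
Proof.
split=> [y z c u v|x z c u v|x y|x z]; rewrite /fun3.
- have updE a : upd (vec2 0 y) ord0 a = vec2 a y.
    by apply/funext => -[[|[|//]] Hi]; rewrite /upd.
  by have := cochain_multilinear f (vec2 0 y) ord0 z c u v; rewrite /= !updE.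
- have updE a : upd (vec2 x 0) ord_max a = vec2 x a.
    by apply/funext => -[[|[|//]] Hi]; rewrite /upd.
  by have := cochain_multilinear f (vec2 x 0) ord_max z c u v; rewrite /= !updE.
- exact: cochain_linear.
- exact: (@cochain_alternating _ _ _ _ f _ ord0 ord_max).
Qed.

Definition cochain2 (t : g -> g -> g -> V) : alternating3 t -> cochain g V 2.
Proof.
move=> H; apply: (@Cochain _ _ _ _ (fun x y => t (x ord0) (x ord_max) y)).
- by move=> x; apply: alt3_3.
- move=> x i y c u v; rewrite /upd; case: i => [[|[|//]] Hi].
    have -> : (ord0 == Ordinal Hi) = true by [].
    have -> : (ord_max == Ordinal Hi) = false by [].
    exact: (alt3_1 H).
  have -> : (ord0 == Ordinal Hi) = false by [].
  have -> : (ord_max == Ordinal Hi) = true by [].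
  exact: (alt3_2 H).
- move=> x i j y ij Eij.
  have ord2P (l : 'I_2) : l = ord0 \/ l = ord_max.
    by case: l => [[|[|//]] Hl]; [left|right]; apply: val_inj.
  have -> : x ord0 = x ord_max.
    by case: (ord2P i) (ord2P j) ij Eij => -> [] ->.
  exact: alt3_alt.
Defined.

Lemma cocycleP (f : cochain g V 2) : cocycle rV f <->
  forall x y z w, cob3 (lact rV) (ract rV) (fun3 f) x y z w = 0.
Proof.
split=> H; first by move=> x y z w; rewrite -d_vec3.
by move=> x w; rewrite (vec3_eta x) d_vec3; apply: H.
Qed.

Lemma cohomologousP (f f' : cochain g V 2) : cohomologous rV f f' <->
  exists2 h : g -> g -> V, bilin h & forall x y z,
    fun3 f' x y z = fun3 f x y z + cob2 (lact rV) (ract rV) h x y z.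
Proof.
split=> [[h hP]|[h hL hP]].
  exists (fun a b => h (vec1 a) b); first exact: cochain1_bilin.
  by move=> x y z; rewrite -d_vec2 -hP addrC subrK.
exists (cochain1 hL) => x z; rewrite (vec2_eta x) d_vec2.
by rewrite [X in X - _ = _]hP addrC addKr.
Qed.

End LowDegreeCochains.

Section Classes.
Variables (k : fieldType) (g : preLieType k) (V : lmodType k).
Variable rV : representation g V.
Implicit Types (E : cm_extension g V) (t : g -> g -> g -> V).

Definition along_l E (rho : g -> ext_n E) (x : g) (u : ext_m E) :=
  lact (ext_act E) (rho x) u.
Definition along_r E (rho : g -> ext_n E) (u : ext_m E) (x : g) :=
  ract (ext_act E) u (rho x).

Definition lifts_defect E (rho : g -> ext_n E) (s : g -> g -> ext_m E) :=
  bilin s /\ forall x y, ext_mu E (s x y) = rho x ∘ rho y - rho (x ∘ y).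

(** A relation and not a function: [t] depends on the section and on the lift of its defect, and is
    determined only up to a coboundary. *)
Definition is_class E t : Prop :=
  exists (rho : {linear g -> ext_n E}) (s : g -> g -> ext_m E),
  [/\ cancel rho (ext_pi E), induced_along rV rho, lifts_defect rho s
    & forall x y z,
      cob2 (along_l rho) (along_r rho) s x y z = ext_i E (t x y z)].

Section WithSections.
Variables (E : cm_extension g V) (rho : {linear g -> ext_n E}).
Variables (s : g -> g -> ext_m E).
Hypotheses (rhoK : cancel rho (ext_pi E)) (sP : lifts_defect rho s).

Let lE := bilE (bilin_lact (ext_act E)).
Let rE := bilE (bilin_ract (ext_act E)).
Let sE := bilE sP.1.

Lemma along_l_bilin : bilin (along_l rho).
Proof.
by split=> [u c x y|x c u v]; rewrite /along_l ?linearP !lE.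
Qed.

Lemma along_r_bilin : bilin (along_r rho).
Proof.
by split=> [x c u v|u c x y]; rewrite /along_r ?linearP !rE.
Qed.

(** mu sends [s x y - s y x] to [rho x, rho y] - rho [x, y], and the Peiffer identity turns the
    action of this difference into a product in m. *)
Lemma along_l_bracket x y u : along_l rho x (along_l rho y u) =
  along_l rho y (along_l rho x u) + along_l rho (bracket x y) u
  + (s x y - s y x) ∘ u.
Proof.
have [_ _ pl _] := ext_cm E; have [_ sM] := sP.
have /eqP := lact_bracket (ext_act E) (rho x) (rho y) u.
rewrite eq_sym subr_eq addrC /along_l => /eqP ->; rewrite -addrA; congr (_ + _).
rewrite -pl -lE; congr (lact _ _ _); rewrite /bracket !linearB /= !sM.
by abel.
Qed.

Lemma along_r_l x y u : along_r rho (along_l rho x u) y =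
  along_l rho x (along_r rho u y) + along_r rho (along_r rho u x) y
  - along_r rho u (x ∘ y) - u ∘ s x y.
Proof.
have [_ _ _ pr] := ext_cm E; have [_ sM] := sP.
have /eqP := lact_ract (ext_act E) (rho x) (rho y) u.
rewrite subr_eq => /eqP; rewrite /along_l /along_r => ->.
rewrite -pr sM !rE.
by abel.
Qed.

Lemma along_l_circ x u v : along_l rho x (u ∘ v) =
  along_l rho x u ∘ v - along_r rho u x ∘ v + u ∘ along_l rho x v.
Proof.
have /eqP := lact_circ (ext_act E) (rho x) u v.
rewrite subr_eq -/(along_l rho x u) => /eqP->.
rewrite -/(along_l rho x (u ∘ v)) -/(along_r rho u x) -/(along_l rho x v).
by abel.
Qed.

Lemma along_r_circ x u v : along_r rho (u ∘ v) x =
  u ∘ along_r rho v x + along_r rho (v ∘ u) x - v ∘ along_r rho u x.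
Proof.
have /eqP := ract_circ (ext_act E) (rho x) u v.
rewrite subr_eq => /eqP; rewrite /along_r => ->.
by abel.
Qed.

Definition along_action : weak_action g (ext_m E) :=
  WeakAction along_l_bilin along_r_bilin sP.1
    along_l_bracket along_r_l along_l_circ along_r_circ.

End WithSections.

Lemma i_linear E : linear (ext_i E).
Proof. exact: linearP. Qed.

Lemma mu_i E v : ext_mu E (ext_i E v) = 0.
Proof. by apply/ext_exactm; exists v. Qed.

Lemma i_circl E v u : ext_i E v ∘ u = 0.
Proof.
by have [_ _ <- _] := ext_cm E; rewrite mu_i (bilE (bilin_lact _)).
Qed.

Lemma i_circr E v u : u ∘ ext_i E v = 0.
Proof.
by have [_ _ _ <-] := ext_cm E; rewrite mu_i (bilE (bilin_ract _)).
Qed.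

Lemma cob2_D (M : lmodType k) (l : g -> M -> M) (r : M -> g -> M)
  (s s' : g -> g -> M) x y z :
  bilin l -> bilin r ->
  cob2 l r (fun a b => s a b + s' a b) x y z
  = cob2 l r s x y z + cob2 l r s' x y z.
Proof.
by move=> lL rL; rewrite /cob2 !(bilE lL, bilE rL); abel.
Qed.

Lemma cob2_0 (M : lmodType k) (l : g -> M -> M) (r : M -> g -> M) x y z :
  bilin l -> bilin r -> cob2 l r (fun _ _ => 0) x y z = 0.
Proof.
by move=> lL rL; rewrite /cob2 !(bilE lL, bilE rL); abel.
Qed.

Lemma cob2_N (M : lmodType k) (l : g -> M -> M) (r : M -> g -> M)
  (s : g -> g -> M) x y z :
  bilin l -> bilin r ->
  cob2 l r (fun a b => - s a b) x y z = - cob2 l r s x y z.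
Proof.
by move=> lL rL; rewrite /cob2 !(bilE lL, bilE rL); abel.
Qed.

Lemma cob2_i E (rho : {linear g -> ext_n E}) h x y z : induced_along rV rho ->
  cob2 (along_l rho) (along_r rho) (fun a b => ext_i E (h a b)) x y z =
  ext_i E (cob2 (lact rV) (ract rV) h x y z).
Proof.
move=> rhoV; have lV a v := (rhoV a v).1; have rV' a v := (rhoV a v).2.
rewrite /cob2 /along_l /along_r -!lV -!rV'.
by rewrite !(linD (i_linear E), linN (i_linear E)).
Qed.

Lemma cob3_i E (rho : {linear g -> ext_n E}) t x y z w : induced_along rV rho ->
  cob3 (along_l rho) (along_r rho) (fun a b c => ext_i E (t a b c)) x y z w =
  ext_i E (cob3 (lact rV) (ract rV) t x y z w).
Proof.
move=> rhoV; have lV a v := (rhoV a v).1; have rV' a v := (rhoV a v).2.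
rewrite /cob3 /along_l /along_r -!lV -!rV'.
by rewrite !(linD (i_linear E), linN (i_linear E)).
Qed.

(** Under the injection of V the claim becomes the vanishing of [cob3] of [cob2] of the defect. *)
Lemma is_class_cocycle E t x y z w :
  is_class E t -> cob3 (lact rV) (ract rV) t x y z w = 0.
Proof.
move=> [rho [s [_ rhoV sP tP]]]; apply: (@ext_exactV _ _ _ E).
rewrite -(cob3_i _ _ _ _ _ rhoV) (lin0 (i_linear E)).
have <- : cob2 (along_l rho) (along_r rho) s = fun a b c => ext_i E (t a b c).
  by apply/funext => a; apply/funext => b; apply/funext => c; apply: tP.
exact: (cob3_cob2 (along_action sP)).
Qed.

Lemma pi_surj_section E : exists rho : {linear g -> ext_n E},
  cancel rho (ext_pi E).
Proof.
have [|F FL FP] := @linear_choice k g (ext_n E) (fun x u => ext_pi E u = x) _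
  (@ext_exactg _ _ _ E).
  by move=> c x a y b <- <-; rewrite linearP.
by exists (lin_pack FL).
Qed.

Lemma defect_lift E (rho : {linear g -> ext_n E}) : cancel rho (ext_pi E) ->
  exists s, lifts_defect rho s.
Proof.
move=> rhoK; have nE := bilE (bilin_circ (ext_n E)).
have gE := bilE (bilin_circ g).
have [||x y|s sL sP] := @bilinear_lift k g g (ext_m E) (ext_n E) (ext_mu E)
  (fun x y => rho x ∘ rho y - rho (x ∘ y)).
- exact: linearP.
- split=> [y c x x'|x c y y'].
    by rewrite !linearP !(nE, gE) !linearP /= !(scalerDr, scalerN); abel.
  by rewrite !linearP !(nE, gE) !linearP /= !(scalerDr, scalerN); abel.
- have /ext_exactn[u ->] : ext_pi E (rho x ∘ rho y - rho (x ∘ y)) = 0.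
    by rewrite linearB /= hom_circ !rhoK subrr.
  by exists u.
by exists s.
Qed.

Lemma cob2_alternating (M : lmodType k) (l : g -> M -> M) (r : M -> g -> M)
  (s : g -> g -> M) : bilin l -> bilin r -> bilin s ->
  [/\ forall y z, linear (fun x => cob2 l r s x y z),
      forall x z, linear (fun y => cob2 l r s x y z),
      forall x y, linear (cob2 l r s x y)
    & forall x z, cob2 l r s x x z = 0].
Proof.
move=> lL rL sL; have gL := bilin_circ g.
split=> [y z c u v|x z c u v|x y c u v|x z]; rewrite /cob2 /bracket.
- rewrite !(bilE lL, bilE rL, bilE sL, bilE gL) !(scalerDr, scalerN).
  by abel.
- rewrite !(bilE lL, bilE rL, bilE sL, bilE gL) !(scalerDr, scalerN).
  by abel.
- rewrite !(bilE lL, bilE rL, bilE sL, bilE gL) !(scalerDr, scalerN).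
  by abel.
rewrite !(bilE lL, bilE rL, bilE sL, bilE gL).
by abel.
Qed.

(** Equivariance of mu moves the computation to n, where the pre-Lie identities of n and g suffice.
    By exactness the coboundary of the defect is thus V-valued. *)
Lemma mu_cob2 E (rho : {linear g -> ext_n E}) s x y z : lifts_defect rho s ->
  ext_mu E (cob2 (along_l rho) (along_r rho) s x y z) = 0.
Proof.
move=> [sL sP]; have [mur mul _ _] := ext_cm E.
have nE := bilE (bilin_circ (ext_n E)).
have muL : linear (ext_mu E) by apply: linearP.
have rhoL : linear rho by apply: linearP.
rewrite /cob2 /along_l /along_r /bracket !(bilE sL).
rewrite !(linD muL, linN muL) !(mur, mul, sP) !nE.
rewrite (circ_swap (rho x) (rho y)) (circ_swap x y) !(linD rhoL, linN rhoL).
by abel.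
Qed.

Lemma is_class_exists E : induces E rV ->
  exists2 t, alternating3 t & is_class E t.
Proof.
move=> [rho rhoK rhoV]; have [s sP] := defect_lift rhoK.
have /choice[t1 /= t1P] : forall p : g * g * g, exists v,
    cob2 (along_l rho) (along_r rho) s p.1.1 p.1.2 p.2 = ext_i E v.
  by move=> p; apply/ext_exactm/mu_cob2.
pose t x y z := t1 (x, y, z).
have tP x y z : cob2 (along_l rho) (along_r rho) s x y z = ext_i E (t x y z).
  exact: t1P (x, y, z).
exists t; last by exists rho, s.
have [c1 c2 c3 c0] := cob2_alternating (along_l_bilin rho)
  (along_r_bilin rho) sP.1.
have iI := @ext_exactV _ _ _ E.
split=> [y z c u v|x z c u v|x y c u v|x z]; apply: iI.
- by rewrite linearP -!tP; apply: c1.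
- by rewrite linearP -!tP; apply: c2.
- by rewrite linearP -!tP; apply: c3.
- by rewrite -tP c0 linear0.
Qed.

(** Adding [ext_i E (h a b)] to the lift of the defect does not change its image under mu. *)
Lemma is_class_shift E t h : bilin h -> is_class E t ->
  is_class E (fun x y z => t x y z + cob2 (lact rV) (ract rV) h x y z).
Proof.
move=> hL [rho [s [rhoK rhoV sP tP]]].
exists rho, (fun a b => s a b + ext_i E (h a b)); split=> //.
- split=> [|x y]; last by rewrite linearD /= sP.2 mu_i addr0.
  split=> [y c u v|x c u v];
  rewrite (bilE sP.1) (bilE hL) (bilE sP.1) (bilE hL);
  by rewrite linearP scalerDr addrACA.
move=> x y z; rewrite cob2_D; last exact: along_r_bilin.
  by rewrite (cob2_i _ _ _ _ rhoV) tP -linearD.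
exact: along_l_bilin.
Qed.

(** The two sections differ by mu ∘ [lam]. Shifting the first data by [lam] preserves the coboundary
    ([cob2_shift]) and gives a second lift [s1] of the defect of [rho']; then [s'] and [s1] differ
    by a V-valued [h]. *)
Lemma is_class_unique E t t' : is_class E t -> is_class E t' ->
  exists2 h, bilin h &
    forall x y z, t' x y z = t x y z + cob2 (lact rV) (ract rV) h x y z.
Proof.
move=> [rho [s [rhoK rhoV sP tP]]] [rho' [s' [rhoK' rhoV' sP' tP']]].
have [mur mul pl pr] := ext_cm E.
have [||lam lamL lamP] := @linear_choice k g (ext_m E)
  (fun x u => ext_mu E u = rho' x - rho x).
- move=> c x a y b; rewrite !linearP => -> ->.
  by rewrite !(scalerDr, scalerN, opprD) /=; abel.
- move=> x; have /ext_exactn[u ->] : ext_pi E (rho' x - rho x) = 0.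
    by rewrite linearB /= rhoK rhoK' subrr.
  by exists u.
have rho'E x : rho' x = rho x + ext_mu E (lam x) by rewrite lamP addrC subrK.
pose B := along_action sP.
pose s1 := shift_defect B lam.
have s1mu x y : ext_mu E (s1 x y) = ext_mu E (s' x y).
  have muL : linear (ext_mu E) by apply: linearP.
  rewrite /s1 /shift_defect sP'.2 /= /along_l /along_r !(linD muL, linN muL).
  rewrite !(mul, mur, hom_circ, sP.2, rho'E) !(bilE (bilin_circ _)).
  by abel.
have s1L : bilin s1.
  have lE := bilE (wl_bilin B); have rE := bilE (wr_bilin B).
  have mE := bilE (bilin_circ (ext_m E)); have gE := bilE (bilin_circ g).
  have sE := bilE (defect_bilin B).
  split=> [y c u v|x c u v]; rewrite /s1 /shift_defect.
    rewrite !(sE, gE, lamL) !(lE, rE, mE) !(scalerDr, scalerN).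
    by abel.
  rewrite !(sE, gE, lamL) !(lE, rE, mE) !(scalerDr, scalerN).
  by abel.
have /choice[h1 /= h1P] : forall p : g * g, exists v,
    s' p.1 p.2 = s1 p.1 p.2 + ext_i E v.
  move=> p; have /ext_exactm[v e] : ext_mu E (s' p.1 p.2 - s1 p.1 p.2) = 0.
    by rewrite linearB /= s1mu subrr.
  by exists v; rewrite -e addrC subrK.
pose h a b := h1 (a, b).
have hP a b : ext_i E (h a b) = s' a b - s1 a b.
  by rewrite [s' a b](h1P (a, b)) addrC addKr.
have iI := @ext_exactV _ _ _ E.
exists h.
  split=> [b c u v|a c u v]; apply: iI; rewrite linearP !hP;
  by rewrite !(bilE sP'.1, bilE s1L) !(scalerDr, scalerN); abel.
move=> x y z; apply: iI; rewrite linearD /= -tP -tP' -(cob2_i _ _ _ _ rhoV').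
rewrite -[X in _ = X + _](cob2_shift B lamL).
have -> : shift_wl B lam = along_l rho'.
  apply/funext => a; apply/funext => u.
  by rewrite /shift_wl /= /along_l rho'E (bilE (bilin_lact _)) pl.
have -> : shift_wr B lam = along_r rho'.
  apply/funext => u; apply/funext => a.
  by rewrite /shift_wr /= /along_r rho'E (bilE (bilin_ract _)) pr.
rewrite -cob2_D; [|exact: along_l_bilin|exact: along_r_bilin].
congr cob2; apply/funext => a; apply/funext => b.
by rewrite hP -/s1 addrC subrK.
Qed.

Lemma is_class_map E E' t : elem_equiv E E' -> is_class E t -> is_class E' t.
Proof.
move=> [r [s [ri smu pis rr rl]]] [rho [sg [rhoK rhoV sP tP]]].
have rL : linear r by apply: linearP.
have srL : linear (s \o rho) by move=> c u v; rewrite /= !linearP.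
exists (lin_pack srL), (fun a b => r (sg a b)); split=> /=.
- by move=> x /=; rewrite pis.
- by move=> x u; have [el er] := rhoV x u; rewrite /= -!ri -rl -rr -el -er.
- split=> [|x y]; last by rewrite -smu sP.2 linearB /= hom_circ.
  split=> [y c u v|x c u v]; rewrite (bilE sP.1) (bilE sP.1);
  by rewrite linearP.
move=> x y z; rewrite -ri -tP /cob2 /along_l /along_r /=.
by rewrite !(linD rL, linN rL) -!rl -!rr.
Qed.

(** V is stable under the action in E because mu kills the result, and the required equations can be
    checked after applying r, which is injective on V since r i = i'. *)
Lemma induces_map_inv E E' : elem_equiv E E' -> induces E' rV -> induces E rV.
Proof.
move=> [r [s [ri smu pis rr rl]]] [rho' rhoK' rhoV'].
have [rho rhoK] := pi_surj_section E; exists rho => //.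
have srL : linear (s \o rho) by move=> c u v; rewrite /= !linearP.
have srV : induced_along rV (lin_pack srL).
  by apply: (induced_along_indep rhoK' _ rhoV') => x /=; rewrite pis.
have [mur mul _ _] := ext_cm E; have nE := bilE (bilin_circ (ext_n E)).
have iI := @ext_exactV _ _ _ E'.
move=> x u; have [/= el er] := srV x u; split.
  have /ext_exactm[v ev] : ext_mu E (lact (ext_act E) (rho x) (ext_i E u)) = 0.
    by rewrite mul mu_i nE.
  by rewrite ev; congr (ext_i E _); apply: iI; rewrite el -!ri -rl ev ri.
have /ext_exactm[v ev] : ext_mu E (ract (ext_act E) (ext_i E u) (rho x)) = 0.
  by rewrite mur mu_i nE.
by rewrite ev; congr (ext_i E _); apply: iI; rewrite er -!ri -rr ev ri.
Qed.

(** Sections of E' do not pull back to E. Instead, some class [t1] of E is pushed to E', compared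
    there with [t], and corrected by a coboundary. *)
Lemma is_class_map_inv E E' t :
  elem_equiv E E' -> is_class E' t -> is_class E t.
Proof.
move=> EE' tP'; have E'V : induces E' rV.
  by have [rho [s [rhoK rhoV _ _]]] := tP'; exists rho.
have [t1 _ t1P] := is_class_exists (induces_map_inv EE' E'V).
have [h hL hE] := is_class_unique (is_class_map EE' t1P) tP'.
have -> : t = fun x y z => t1 x y z + cob2 (lact rV) (ract rV) h x y z.
  by apply/funext => x; apply/funext => y; apply/funext => z.
exact: is_class_shift.
Qed.

Lemma ext_equiv_is_class E E' t :
  ext_equiv E E' -> is_class E t <-> is_class E' t.
Proof.
elim=> {E E'} [E E' EE'|E|E E' _ [H1 H2]|E E' E'' _ [H1 H2] _ [H3 H4]].
- by split; [apply: is_class_map|apply: is_class_map_inv].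
- by [].
- by split.
- by split=> H; [apply/H3/H1|apply/H2/H4].
Qed.

(** For the section x |-> (0, x), the operators and a lift of the defect are those of the datum. *)
Lemma is_class_realization (D : crossed_datum rV) :
  is_class (realization D) (cd_class D).
Proof.
have rhoL : linear (fun x : g => (0, x) : cd_ext D).
  move=> c u v; change ((0, c *: u + v) = (c *: 0 + 0, c *: u + v) :> cd_ext D).
  by rewrite scaler0 addr0.
have lE := bilE (wl_bilin (cd_act D)); have rE := bilE (wr_bilin (cd_act D)).
have mE := bilE (bilin_circ (cd_m D)).
have l0 : cd_val (0 : cd_quo D) = 0.
  by rewrite (lin0 (@cd_val_linear _ _ _ _ D)).
have al x u :
    along_l (E := realization D) (lin_pack rhoL) x u = wl (cd_act D) x u.
  by rewrite /along_l /= /cd_lact /= l0 mE add0r.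
have ar x u :
    along_r (E := realization D) (lin_pack rhoL) u x = wr (cd_act D) u x.
  by rewrite /along_r /= /cd_ract /= l0 mE add0r.
exists (lin_pack rhoL), (defect (cd_act D)); split=> //.
- move=> x v; have := al x (cd_j D v); have := ar x (cd_j D v).
  by rewrite /along_l /along_r /= => -> ->; rewrite cd_wl cd_wr.
- split=> [|x y]; first exact: defect_bilin.
  rewrite /= /cd_mu_fun.
  change ((cd_proj (defect (cd_act D) x y), 0) =
    (cd_proj (cd_mul (cd_val (0 : cd_quo D), x) (cd_val (0 : cd_quo D), y)) - 0,
      x ∘ y - x ∘ y) :> cd_ext D).
  by rewrite subrr subr0 l0 /cd_mul /= !(lE, rE, mE) !add0r.
move=> x y z; rewrite -[RHS]cd_classE.
by congr cob2; apply/funext => a; apply/funext => b; [apply: al|apply: ar].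
Qed.

End Classes.

(** * Extensions with the same class *)

Section ProductPreLie.
Variables (k : fieldType) (M N : preLieType k).

Definition prod_circ (p q : M * N) : M * N := (p.1 ∘ q.1, p.2 ∘ q.2).

Fact prod_circ_linearl q : linear (prod_circ^~ q).
Proof. by move=> c u v; congr pair; apply: circ_linearl. Qed.

Fact prod_circ_linearr p : linear (prod_circ p).
Proof. by move=> c u v; congr pair; apply: circ_linearr. Qed.

Fact prod_circ_preLie p q s :
  prod_circ (prod_circ p q) s - prod_circ p (prod_circ q s) =
  prod_circ (prod_circ q p) s - prod_circ q (prod_circ p s).
Proof. by congr pair; apply: circ_preLie. Qed.

HB.instance Definition _ := isPreLie.Build k (M * N)%type
  prod_circ_linearl prod_circ_linearr prod_circ_preLie.

Section ProductAction.
Variables (g : preLieType k) (A : weak_action g M) (B : weak_action g N).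

Definition prod_wl (x : g) (u : M * N) : M * N := (wl A x u.1, wl B x u.2).
Definition prod_wr (u : M * N) (x : g) : M * N := (wr A u.1 x, wr B u.2 x).
Definition prod_defect (x y : g) : M * N := (defect A x y, defect B x y).

Fact prod_wl_bilin : bilin prod_wl.
Proof.
by split=> [u c x y|x c u v]; congr pair; do ?[exact: (wl_bilin _).1];
  exact: (wl_bilin _).2.
Qed.

Fact prod_wr_bilin : bilin prod_wr.
Proof.
by split=> [u c x y|x c u v]; congr pair; do ?[exact: (wr_bilin _).1];
  exact: (wr_bilin _).2.
Qed.

Fact prod_defect_bilin : bilin prod_defect.
Proof.
by split=> [u c x y|x c u v]; congr pair; do ?[exact: (defect_bilin _).1];
  exact: (defect_bilin _).2.
Qed.

Fact prod_wl_bracket x y u : prod_wl x (prod_wl y u) =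
  prod_wl y (prod_wl x u) + prod_wl (bracket x y) u
  + (prod_defect x y - prod_defect y x) ∘ u.
Proof. by congr pair; apply: wl_bracket. Qed.

Fact prod_wr_wl x y u : prod_wr (prod_wl x u) y =
  prod_wl x (prod_wr u y) + prod_wr (prod_wr u x) y - prod_wr u (x ∘ y)
  - u ∘ prod_defect x y.
Proof. by congr pair; apply: wr_wl. Qed.

Fact prod_wl_circ x u v : prod_wl x (u ∘ v) =
  prod_wl x u ∘ v - prod_wr u x ∘ v + u ∘ prod_wl x v.
Proof. by congr pair; apply: wl_circ. Qed.

Fact prod_wr_circ x u v : prod_wr (u ∘ v) x =
  u ∘ prod_wr v x + prod_wr (v ∘ u) x - v ∘ prod_wr u x.
Proof. by congr pair; apply: wr_circ. Qed.

Definition prod_weak_action : weak_action g (M * N)%type :=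
  WeakAction prod_wl_bilin prod_wr_bilin prod_defect_bilin
    prod_wl_bracket prod_wr_wl prod_wl_circ prod_wr_circ.

End ProductAction.
End ProductPreLie.

Section Comparison.
Variables (k : fieldType) (g : preLieType k) (V : lmodType k).
Variable rV : representation g V.

Section RealizationMap.
Variables (D : crossed_datum rV) (E : cm_extension g V).
Variables (rho : {linear g -> ext_n E}) (s : g -> g -> ext_m E).
Hypotheses (rhoK : cancel rho (ext_pi E)) (sP : lifts_defect rho s).
Variable f : preLie_hom (cd_m D) (ext_m E).
Hypotheses (f_wl : forall x u, f (wl (cd_act D) x u) = along_l rho x (f u))
  (f_wr : forall x u, f (wr (cd_act D) u x) = along_r rho (f u) x)
  (f_defect : forall x y, f (defect (cd_act D) x y) = s x y)
  (f_j : forall v, f (cd_j D v) = ext_i E v).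

Let fL : linear f. Proof. exact: linearP. Qed.
Let muL : linear (ext_mu E). Proof. exact: linearP. Qed.
Let rhoL : linear rho. Proof. exact: linearP. Qed.

(** The choice of the representative in M is harmless: [f] maps V onto the kernel of mu
    ([mu_f_proj]). *)
Definition real_map_fun (p : cd_ext D) : ext_n E :=
  ext_mu E (f (cd_val p.1)) + rho p.2.

Lemma real_map_linear : linear real_map_fun.
Proof.
move=> c p q; rewrite /real_map_fun (cd_val_linear c p.1 q.1) fL muL.
rewrite (rhoL c p.2 q.2) scalerDr.
by abel.
Qed.

Lemma mu_f_proj u : ext_mu E (f (cd_val (cd_proj u))) = ext_mu E (f u).
Proof.
by rewrite cd_valE (linD fL) (linN fL) f_j (linD muL) (linN muL) mu_i subr0.
Qed.

Lemma real_map_circ p q :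
  real_map_fun (p ∘ q) = real_map_fun p ∘ real_map_fun q.
Proof.
have [mur mul _ _] := ext_cm E; have nE := bilE (bilin_circ (ext_n E)).
rewrite /real_map_fun [p ∘ q]/(cd_circ p q) /= mu_f_proj /cd_mul /=.
rewrite !(linD fL) f_defect f_wl f_wr hom_circ !(linD muL) hom_circ sP.2.
by rewrite mul mur !nE; abel.
Qed.

Definition real_map : preLie_hom (cd_ext D) (ext_n E) :=
  @PreLieHom _ (cd_ext D) (ext_n E) (lin_pack real_map_linear) real_map_circ.

Lemma realization_map : elem_equiv (realization D) E.
Proof.
have [mur mul pl pr] := ext_cm E; exists f, real_map; split=> //=.
- move=> u; rewrite /real_map_fun /= mu_f_proj (lin0 rhoL) addr0.
  by [].
- move=> p; rewrite /real_map_fun linearD /= rhoK.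
  have -> : ext_pi E (ext_mu E (f (cd_val p.1))) = 0.
    by apply/ext_exactn; exists (f (cd_val p.1)).
  by rewrite add0r.
- move=> p u; rewrite /cd_ract /real_map_fun (linD fL) hom_circ f_wr.
  by rewrite (bilE (bilin_ract _)) pr.
- move=> p u; rewrite /cd_lact /real_map_fun (linD fL) hom_circ f_wl.
  by rewrite (bilE (bilin_lact _)) pl.
Qed.

End RealizationMap.

(* Two extensions with the same class are both images of the realization of
   the product of their data, in which V is embedded diagonally. *)
Lemma is_class_equiv (E E' : cm_extension g V) t :
  is_class rV E t -> is_class rV E' t -> ext_equiv E E'.
Proof.
move=> [rho [s [rhoK rhoV sP tP]]] [rho' [s' [rhoK' rhoV' sP' tP']]].
pose A := prod_weak_action (along_action sP) (along_action sP').
pose j (v : V) : (ext_m E * ext_m E')%type := (ext_i E v, ext_i E' v).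
have jL : linear j by move=> c u v; congr pair; apply: linearP.
have jI : injective j by move=> u v [/ext_exactV].
have jl v (u : (ext_m E * ext_m E')%type) : j v ∘ u = 0.
  by congr pair; apply: i_circl.
have jr v (u : (ext_m E * ext_m E')%type) : u ∘ j v = 0.
  by congr pair; apply: i_circr.
have jwl x v : wl A x (j v) = j (lact rV x v).
  by congr pair; rewrite /= /along_l ?(rhoV x v).1 ?(rhoV' x v).1.
have jwr x v : wr A (j v) x = j (ract rV v x).
  by congr pair; rewrite /= /along_r ?(rhoV x v).2 ?(rhoV' x v).2.
have jt x y z : cob2 (wl A) (wr A) (defect A) x y z = j (t x y z).
  by rewrite /j -tP -tP'.
pose D := CrossedDatum jL jI jl jr jwl jwr jt.
pose M := (ext_m E * ext_m E')%type.
have fstL : linear (fst : M -> ext_m E) by [].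
have sndL : linear (snd : M -> ext_m E') by [].
pose f1 := @PreLieHom _ M (ext_m E) (lin_pack fstL) (fun _ _ => erefl).
pose f2 := @PreLieHom _ M (ext_m E') (lin_pack sndL) (fun _ _ => erefl).
apply: (@Relation_Operators.rst_trans _ _ _ (realization D)).
  apply: Relation_Operators.rst_sym; apply: Relation_Operators.rst_step.
  exact: (@realization_map D E rho s rhoK sP f1).
apply: Relation_Operators.rst_step.
exact: (@realization_map D E' rho' s' rhoK' sP' f2).
Qed.

End Comparison.

(** * Exactness of the Koszul complex *)

Lemma perm_rem (T : eqType) (x : T) s t :
  perm_eq s t -> perm_eq (rem x s) (rem x t).
Proof.
move=> st; have [xs|xs] := boolP (x \in s); last first.
  by rewrite !rem_id // -(perm_mem st).
have xt : x \in t by rewrite -(perm_mem st).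
rewrite -(perm_cons x) -(permPl (perm_to_rem xs)).
by rewrite -(permPr (perm_to_rem xt)).
Qed.

Section Multilinear.
Variables (k : fieldType) (g V : lmodType k).

(* A function on words restricts to one map on each g^n; symmetric multilinear
   functions are the elements of the dual Hom(S(g), V) of the symmetric
   algebra. *)
Definition mlin (f : seq g -> V) : Prop :=
  forall s1 s2, linear (fun a => f (s1 ++ a :: s2)).

Definition msym (f : seq g -> V) : Prop :=
  forall s1 a b s2, f (s1 ++ [:: a, b & s2]) = f (s1 ++ [:: b, a & s2]).

Lemma mlin_cons f x : mlin f -> mlin (fun s => f (x :: s)).
Proof. by move=> fL s1 s2; apply: (fL (x :: s1)). Qed.

Lemma msym_cons f x : msym f -> msym (fun s => f (x :: s)).
Proof. by move=> fS s1 a b s2; apply: (fS (x :: s1)). Qed.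

(** Adjacent exchanges bring the first letter of [s] to the front of [t]. *)
Lemma msym_perm f s t : msym f -> perm_eq s t -> f s = f t.
Proof.
move=> fS; elim: s f fS t => [|x s IHs] f fS t.
  by rewrite perm_sym => /perm_nilP->.
move=> st; have xt : x \in t by rewrite -(perm_mem st) mem_head.
have -> : f t = f (x :: rem x t).
  move: xt; clear -fS; elim: t f fS => // y t IHt f fS; rewrite inE /=.
  have [-> //|xy /= xt] := eqVneq y x.
  by rewrite (IHt _ (msym_cons y fS) xt); apply: (fS [::]).
apply: (IHs _ (msym_cons x fS)); rewrite -(perm_cons x).
by rewrite (perm_trans st) // perm_to_rem.
Qed.

Fixpoint basic (s : seq g) : Prop :=
  if s is x :: s' then basis x /\ basic s' else True.

Lemma mlin_eq f h : mlin f -> mlin h ->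
  (forall s, basic s -> f s = h s) -> f =1 h.
Proof.
move=> fL hL fh s; elim: s f h fL hL fh => [|x s IHs] f h fL hL fh.
  exact: fh.
apply: (basis_eq (F := fun x => f (x :: s)) (G := fun x => h (x :: s))).
- exact: (fL [::]).
- exact: (hL [::]).
move=> e eI; apply: IHs (mlin_cons e fL) (mlin_cons e hL) _ => t tI.
exact: fh.
Qed.

Definition ext1 (f : g -> V) : g -> V := s2val (cid2 (basis_extend f)).

Lemma ext1_linear f : linear (ext1 f).
Proof. by rewrite /ext1; case: cid2. Qed.

Lemma ext1E f x : basis x -> ext1 f x = f x.
Proof. by rewrite /ext1; case: cid2 => F FL FP /=; apply: FP. Qed.

Lemma ext1_comb c f f1 f2 :
  (forall e, basis e -> f e = c *: f1 e + f2 e) ->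
  forall x, ext1 f x = c *: ext1 f1 x + ext1 f2 x.
Proof.
move=> H; apply: basis_eq => [|a u v|x Ix]; first exact: ext1_linear.
  by rewrite !ext1_linear !scalerDr !scalerA (mulrC c) addrACA.
by rewrite !ext1E // H.
Qed.

Lemma ext1_eq f h : (forall e, basis e -> f e = h e) -> ext1 f =1 ext1 h.
Proof.
move=> H; apply: basis_eq; [exact: ext1_linear|exact: ext1_linear|].
by move=> x Ix; rewrite !ext1E // H.
Qed.

(** Both orders of expansion are bilinear in [x] and [y] and agree on pairs of basis vectors. *)
Lemma ext1_swap (h : g -> g -> V) x y :
  (forall e e', basis e -> basis e' -> h e e' = h e' e) ->
  ext1 (fun e => ext1 (h e) y) x = ext1 (fun e => ext1 (h e) x) y.
Proof.
move=> hS; pose H a b := ext1 (fun e => ext1 (h e) b) a.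
have HL a : linear (H a).
  move=> c u v; apply: ext1_comb => e _; exact: ext1_linear.
suff: forall a b, H a b = H b a by apply.
move=> a b; apply: (basis_eq (F := H^~ b) (G := H b)) a => [||a Ia].
- exact: ext1_linear.
- exact: HL.
apply: (basis_eq (F := H a) (G := H^~ a)) b => [||b Ib].
- exact: HL.
- exact: ext1_linear.
by rewrite /H !ext1E // hS.
Qed.

(** The multilinear function with the values of [f] on words in basis vectors. Letters are expanded
    from the left, which is why symmetry rests on [ext1_swap]. *)
Fixpoint mext (s : seq g) (f : seq g -> V) : V :=
  if s is x :: s' then ext1 (fun e => mext s' (fun t => f (e :: t))) x
  else f [::].

Lemma mext_eq s f h :
  (forall t, size t = size s -> basic t -> f t = h t) -> mext s f = mext s h.
Proof.
elim: s f h => [|x s IHs] f h fh /=; first exact: fh.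
apply: ext1_eq => e Ie; apply: IHs => t ts tI.
by apply: fh => //=; rewrite ts.
Qed.

Lemma mext_comb c s f f1 f2 : (forall t, f t = c *: f1 t + f2 t) ->
  mext s f = c *: mext s f1 + mext s f2.
Proof.
elim: s f f1 f2 => [|x s IHs] f f1 f2 fE //=.
by apply: ext1_comb => e _; apply: IHs => t.
Qed.

Lemma mext_mlin f : mlin (fun s => mext s f).
Proof.
move=> s1 s2; elim: s1 f => [|x s1 IHs] f; first exact: ext1_linear.
by move=> c u v /=; apply: ext1_comb => e _; apply: IHs.
Qed.

Lemma mext_basic s f : basic s -> mext s f = f s.
Proof.
elim: s f => [|x s IHs] f //= [Ix Is].
by rewrite ext1E // IHs.
Qed.

Lemma mext_msym f :
  (forall s1 a b s2, basic (s1 ++ [:: a, b & s2]) ->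
    f (s1 ++ [:: a, b & s2]) = f (s1 ++ [:: b, a & s2])) ->
  msym (fun s => mext s f).
Proof.
move=> fS s1 a b s2; elim: s1 f fS => [|x s1 IHs] f fS /=.
  apply: ext1_swap => e e' Ie Ie'; apply: mext_eq => t _ It.
  exact: (fS [::]).
apply: ext1_eq => e Ie; apply: IHs => t1 c d t2 It.
exact: (fS (e :: t1)).
Qed.

End Multilinear.

(** * The contraction of the Koszul complex *)

Section Koszul.
Variables (k : fieldType) (g V : lmodType k).
Implicit Types (K : g -> g -> seq g -> V) (s t : seq g).

(** The default matters: [koszul_basic] takes its first letter for [x0], so that a one-letter word
    falls in the zero branch. *)
Definition least (x0 : g) s : g := head x0 (sort (@bleq k g) s).

Lemma least_mem x0 s : s != [::] -> least x0 s \in s.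
Proof.
rewrite /least -(mem_sort (@bleq k g)) -size_eq0 -(size_sort (@bleq k g)).
by case: sort => //= x s' _; rewrite mem_head.
Qed.

Lemma least_le x0 s x : x \in s -> bleq (least x0 s) x.
Proof.
rewrite /least -(mem_sort (@bleq k g)).
have := sort_sorted (@bleq_total k g) s.
case: sort => //= y s' /(order_path_min (@bleq_trans k g))/allP ys.
by rewrite inE => /predU1P[->|/ys //]; apply: bleq_refl.
Qed.

Lemma leastE x0 s x : x \in s -> (forall y, y \in s -> bleq x y) ->
  least x0 s = x.
Proof.
move=> xs xmin; apply: bleq_anti; rewrite least_le //= xmin // least_mem //.
by apply: contraTneq xs => ->.
Qed.

(* The contraction of the Koszul complex attached to an ordered basis moves the
   least vector of a monomial out of it; unlike the symmetrized contraction it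
   involves no division by the degree. *)
Definition koszul_basic K t : V :=
  if t is e :: s then
    let m := least e s in
    if bleq e m then 0 else K e m (rem m s)
  else 0.

Definition koszul K (x : g) (s : seq g) : V := mext (x :: s) (koszul_basic K).

Lemma koszul_linear K s : linear (fun x => koszul K x s).
Proof. exact: (mext_mlin (koszul_basic K) [::] s). Qed.

Lemma koszul_mlin K x : mlin (koszul K x).
Proof. by move=> s1 s2; apply: (mext_mlin (koszul_basic K) (x :: s1) s2). Qed.

Lemma koszul_msym K x : (forall y z, msym (K y z)) -> msym (koszul K x).
Proof.
move=> KS s1 a b s2; apply: ext1_eq => e Ie.
apply: (@mext_msym _ _ _ (fun t => koszul_basic K (e :: t))).
move=> {}s1 {}a {}b {}s2 _.
have P : perm_eq (s1 ++ [:: a, b & s2]) (s1 ++ [:: b, a & s2]).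
  by rewrite perm_cat2l (perm_catCA [:: a] [:: b]).
have E : least e (s1 ++ [:: a, b & s2]) = least e (s1 ++ [:: b, a & s2]).
  congr head; apply/perm_sortP => //; [exact: bleq_total|exact: bleq_trans|].
  exact: bleq_anti.
rewrite /koszul_basic E; case: ifP => // _.
by apply: msym_perm; [apply: KS|apply: perm_rem].
Qed.

Lemma koszul_comb c K K1 K2 x s :
  (forall y z t, K y z t = c *: K1 y z t + K2 y z t) ->
  koszul K x s = c *: koszul K1 x s + koszul K2 x s.
Proof.
move=> KE; apply: mext_comb => -[|e t] /=; first by rewrite scaler0 addr0.
by case: ifP => _; rewrite ?scaler0 ?addr0.
Qed.

Lemma koszul_degree n K x s : (forall y z t, size t != n -> K y z t = 0) ->
  size s != n.+1 -> koszul K x s = 0.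
Proof.
move=> K0 sn.
have -> : koszul K x s = mext (x :: s) (fun=> 0).
  apply: mext_eq => -[|e t] //= [ts] _; case: ifP => // em.
  have t0 : t != [::].
    by apply: contraFneq em => ->; rewrite /least /= bleq_refl.
  apply: K0; rewrite size_rem ?least_mem // ts.
  by move: t0 sn; rewrite -size_eq0 ts; case: (size s).
have := @mext_comb k g V (-1) (x :: s) (fun=> 0) (fun=> 0) (fun=> 0).
by rewrite !scaleN1r !addNr; apply.
Qed.

(** By multilinearity only basis words matter. If [x] or [y] is a least letter, one contraction
    vanishes and the other returns the value of [K] up to sign. Otherwise the least letter lies in
    the word, both contractions extract it, and the cyclic identity, that is closedness,
    concludes. *)
Lemma koszul_solves K :
  (forall y t, linear (fun x => K x y t)) ->
  (forall x t, linear (fun y => K x y t)) ->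
  (forall x y, mlin (K x y)) -> (forall x y, msym (K x y)) ->
  (forall x t, K x x t = 0) -> (forall x y t, K x y t = - K y x t) ->
  (forall x y z t, K x y (z :: t) + K y z (x :: t) + K z x (y :: t) = 0) ->
  forall x y t, koszul K x (y :: t) - koszul K y (x :: t) = K x y t.
Proof.
move=> K1 K2 KL KS Kalt Kanti Kcyc x y t.
pose F a b s := koszul K a (b :: s) - koszul K b (a :: s).
have kL a s : linear (fun b => koszul K a (b :: s)).
  exact: (koszul_mlin K a [::] s).
have bL b s : linear (fun a => koszul K a (b :: s)) by apply: koszul_linear.
have lin_sub (f1 f2 : g -> V) : linear f1 -> linear f2 ->
    linear (fun a => f1 a - f2 a).
  by move=> L1 L2 c u v; rewrite L1 L2 scalerBr opprD addrACA.
apply: (basis_eq (F := fun x => F x y t) (G := fun x => K x y t)) x => //.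
  by apply: lin_sub; [apply: bL|apply: kL].
move=> x Ix.
apply: (basis_eq (F := fun y => F x y t) (G := fun y => K x y t)) y => //.
  by apply: lin_sub; [apply: kL|apply: bL].
move=> y Iy; apply: (mlin_eq (f := F x y) (h := K x y)) t => //.
  move=> s1 s2; apply: lin_sub.
    exact: (koszul_mlin K x (y :: s1) s2).
  exact: (koszul_mlin K y (x :: s1) s2).
move=> s Is; rewrite /F /koszul !mext_basic //=.
set m1 := least x (y :: s); set m2 := least y (x :: s).
have m1min a : a \in y :: s -> bleq m1 a by apply: least_le.
have m2min a : a \in x :: s -> bleq m2 a by apply: least_le.
have m1in : m1 \in y :: s by apply: least_mem.
have m2in : m2 \in x :: s by apply: least_mem.
case: ifPn => xm1.
  have m2x : m2 = x.
    apply: leastE; first exact: mem_head.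
    move=> a; rewrite inE => /predU1P[->|as_]; first exact: bleq_refl.
    by apply: bleq_trans xm1 _; apply: m1min; rewrite inE as_ orbT.
  rewrite m2x eqxx sub0r; case: ifPn => yx; last by rewrite -Kanti.
  have xy : bleq x y by apply: bleq_trans xm1 _; apply: m1min; apply: mem_head.
  have -> : y = x by apply: bleq_anti; rewrite yx.
  by rewrite oppr0 Kalt.
case: (boolP (bleq y m2)) => ym2.
  have m1y : m1 = y.
    apply: leastE; first exact: mem_head.
    move=> a; rewrite inE => /predU1P[->|as_]; first exact: bleq_refl.
    by apply: bleq_trans ym2 _; apply: m2min; rewrite inE as_ orbT.
  by rewrite m1y eqxx subr0.
have m1x : bleq m1 x by have := bleq_total x m1; rewrite (negPf xm1).
have m2y : bleq m2 y by have := bleq_total y m2; rewrite (negPf ym2).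
have m1s : m1 \in s.
  move: m1in; rewrite inE => /predU1P[E|//]; case/negP: ym2.
  move: m2in; rewrite inE => /predU1P[->|m2s]; first by rewrite -E.
  by rewrite -E; apply: m1min; rewrite inE m2s orbT.
have m2s : m2 \in s.
  move: m2in; rewrite inE => /predU1P[E|//]; case/negP: xm1.
  by rewrite -E; apply: m2min; rewrite inE m1s orbT.
have m12 : m1 = m2.
  by apply: bleq_anti; rewrite m1min ?inE ?m2s ?orbT // m2min // inE m1s orbT.
have -> : (y == m1) = false.
  by apply: contraNF ym2 => /eqP->; rewrite m12 bleq_refl.
have -> : (x == m2) = false.
  by apply: contraNF xm1 => /eqP->; rewrite m12 bleq_refl.
rewrite -m12; have -> : K x y s = K x y (m1 :: rem m1 s).
  by apply: msym_perm => //; apply: perm_to_rem.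
have /eqP := Kcyc x y m1 (rem m1 s).
rewrite -addrA addr_eq0 => /eqP->; rewrite (Kanti m1 x).
by abel.
Qed.

End Koszul.

(** * Effacing a cocycle *)

Section WordDerivation.
Variables (k : fieldType) (g : preLieType k) (V : lmodType k).
Implicit Types (f h : seq g -> V) (s t : seq g).

(* f evaluated at the image of s under the derivation extending x ∘ _ *)
Fixpoint derive_word f (x : g) s : V :=
  if s is y :: s' then
    f (x ∘ y :: s') + derive_word (fun t => f (y :: t)) x s'
  else 0.

Lemma derive_word_eq f h x s : (forall t, size t = size s -> f t = h t) ->
  derive_word f x s = derive_word h x s.
Proof.
elim: s f h => //= y s IHs f h fh; rewrite fh //; congr (_ + _).
by apply: IHs => t ts; apply: fh; rewrite /= ts.
Qed.

Lemma derive_word0 f x s : (forall t, size t = size s -> f t = 0) ->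
  derive_word f x s = 0.
Proof.
elim: s f => //= y s IHs f f0; rewrite f0 // add0r.
by apply: IHs => t ts; apply: f0; rewrite /= ts.
Qed.

Lemma derive_word_comb c f f1 f2 x s : (forall t, f t = c *: f1 t + f2 t) ->
  derive_word f x s = c *: derive_word f1 x s + derive_word f2 x s.
Proof.
elim: s f f1 f2 => [|y s IHs] f f1 f2 fE /=; first by rewrite scaler0 addr0.
rewrite fE (IHs _ (fun t => f1 (y :: t)) (fun t => f2 (y :: t))) //.
by rewrite scalerDr addrACA.
Qed.

Lemma derive_word_comp (L : V -> V) f x s : linear L ->
  derive_word (fun t => L (f t)) x s = L (derive_word f x s).
Proof.
move=> LL; elim: s f => [|y s IHs] f /=; first by rewrite (lin0 LL).
by rewrite IHs (linD LL).
Qed.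

Lemma derive_word_cat f x s t : derive_word f x (s ++ t) =
  derive_word (fun s' => f (s' ++ t)) x s
  + derive_word (fun t' => f (s ++ t')) x t.
Proof.
elim: s f => [|y s IHs] f /=; first by rewrite add0r.
by rewrite IHs addrA.
Qed.

Lemma derive_word_linear f s : mlin f -> linear (fun x => derive_word f x s).
Proof.
move=> fL c u v; elim: s f fL => [|y s IHs] f fL /=.
  by rewrite scaler0 addr0.
rewrite (IHs _ (mlin_cons y fL)) !(bilE (bilin_circ g)).
by rewrite (fL [::] s c (u ∘ y) (v ∘ y)) scalerDr addrACA.
Qed.

Lemma derive_word_mlin f x : mlin f -> mlin (derive_word f x).
Proof.
move=> fL s1 s2 c u v; rewrite !derive_word_cat /=.
rewrite (@derive_word_comb c _ (fun t => f (t ++ u :: s2))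
  (fun t => f (t ++ v :: s2))); last by move=> t; apply: fL.
rewrite (@derive_word_comb c (fun t => f (s1 ++ (c *: u + v) :: t))
  (fun t => f (s1 ++ u :: t)) (fun t => f (s1 ++ v :: t))); last first.
  by move=> t; apply: fL.
rewrite !(bilE (bilin_circ g)) fL !scalerDr.
by abel.
Qed.

Lemma derive_word_msym f x : msym f -> msym (derive_word f x).
Proof.
move=> fS s1 a b s2; rewrite !derive_word_cat /=.
rewrite (@derive_word_eq _ (fun t => f (t ++ [:: b, a & s2])) x s1); last first.
  by move=> t _; apply: fS.
rewrite (@derive_word_eq _ (fun t => f (s1 ++ [:: b, a & t])) x s2); last first.
  by move=> t _; apply: fS.
rewrite (fS s1 _ b) (fS s1 a).
by abel.
Qed.

(** This is dual to [D_x, D_y] = D_[x,y]: on one letter it is the pre-Lie identity, and the terms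
    deriving two different letters are symmetric. *)
Lemma derive_word_bracket f x y s : mlin f ->
  derive_word (fun t => derive_word f y t) x s =
  derive_word (fun t => derive_word f x t) y s
  - derive_word f (bracket x y) s.
Proof.
elim: s f => [|z s IHs] f fL /=; first by rewrite subr0.
have dD h1 h2 a : derive_word (fun t => h1 t + h2 t) a s =
    derive_word h1 a s + derive_word h2 a s.
  rewrite (@derive_word_comb 1 _ h1 h2) ?scale1r // => t.
  by rewrite scale1r.
rewrite !dD (IHs _ (mlin_cons z fL)).
have hL : linear (fun a => f (a :: s)) by exact: (fL [::]).
rewrite /bracket !(bilE (bilin_circ g)) (circ_swap x y).
rewrite !(linD hL, linN hL).
by abel.
Qed.

End WordDerivation.

(** * Representations as weak actions on a zero product *)

Section RepAction.
Variables (k : fieldType) (g : preLieType k) (M : lmodType k).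
Variables (r : representation g M) (s : g -> g -> M).
Hypothesis sL : bilin s.

Let Z := zero_preLie M.

Fact rep_bracket x y (u : Z) : lact r x (lact r y u) =
  lact r y (lact r x u) + lact r (bracket x y) u + (s x y - s y x : Z) ∘ u.
Proof.
rewrite [_ ∘ u](_ : _ = 0) // addr0 lact_bracket.
by rewrite addrC subrK.
Qed.

Fact rep_ract x y (u : Z) : ract r (lact r x u) y =
  lact r x (ract r u y) + ract r (ract r u x) y - ract r u (x ∘ y)
  - u ∘ (s x y : Z).
Proof.
rewrite [u ∘ _](_ : _ = 0) // subr0.
have /eqP := lact_ract r x y u; rewrite subr_eq => /eqP->.
by abel.
Qed.

Fact rep_lact_circ x (u v : Z) : lact r x (u ∘ v) =
  (lact r x u : Z) ∘ v - (ract r u x : Z) ∘ v + u ∘ (lact r x v : Z).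
Proof.
have E (a b : Z) : a ∘ b = 0 by [].
by rewrite !E (bil0r (bilin_lact r)) subrr addr0.
Qed.

Fact rep_ract_circ x (u v : Z) : ract r (u ∘ v) x =
  u ∘ (ract r v x : Z) + ract r (v ∘ u) x - v ∘ (ract r u x : Z).
Proof.
have E (a b : Z) : a ∘ b = 0 by [].
by rewrite !E (bil0l (bilin_ract r)) subr0 addr0.
Qed.

(** With the zero product the defect disappears from the laws, so any bilinear map can serve as
    defect. *)
Definition rep_action : weak_action g Z :=
  @WeakAction _ g Z _ _ s (bilin_lact r) (bilin_ract r) sL
    rep_bracket rep_ract rep_lact_circ rep_ract_circ.

End RepAction.

(** * The representation on Hom(S(g), V) *)

Section CoinducedModule.
Variables (k : fieldType) (g : preLieType k) (V : lmodType k).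
Variable rV : representation g V.

Definition sym_mlin : {pred (seq g -> V)} := fun f => `[< mlin f /\ msym f >].

Fact sym_mlin_submod : submod_closed sym_mlin.
Proof.
split=> [|c f h].
  by apply/asboolP; split=> // s1 s2 c u v; rewrite scaler0 addr0.
rewrite !unfold_in => /asboolP[fL fS] /asboolP[hL hS]; apply/asboolP.
have E s : (c *: f + h) s = c *: f s + h s by [].
split=> [s1 s2 a u v|s1 a b s2]; rewrite !E.
  by rewrite fL hL !scalerDr !scalerA (mulrC c) addrACA.
by rewrite fS hS.
Qed.

HB.instance Definition _ :=
  GRing.isSubmodClosed.Build k (seq g -> V) sym_mlin sym_mlin_submod.

Definition coind : Type := {f : seq g -> V | f \in sym_mlin}.

HB.instance Definition _ := SubType.on coind.
HB.instance Definition _ := [Choice of coind by <:].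
HB.instance Definition _ := [SubChoice_isSubLmodule of coind by <:].

Definition cval (f : coind) : seq g -> V := val f.

Lemma cval_linear s : linear (cval^~ s).
Proof. by move=> c f h; rewrite /cval linearP. Qed.

Lemma cval_inj (f h : coind) : (forall s, cval f s = cval h s) -> f = h.
Proof. by move=> fh; apply/val_inj/funext. Qed.

Lemma cval_mlin f : mlin (cval f).
Proof. by have /asboolP[] := valP f. Qed.

Lemma cval_msym f : msym (cval f).
Proof. by have /asboolP[] := valP f. Qed.

Fact coind_subproof f : mlin f /\ msym f -> f \in sym_mlin.
Proof. by move=> ?; apply/asboolP. Qed.

Definition mk_coind f (H : mlin f /\ msym f) : coind :=
  exist (fun f => f \in sym_mlin) f (coind_subproof H).

Let vE s := (linD (cval_linear s), linN (cval_linear s),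
  linZ (cval_linear s), lin0 (cval_linear s)).
Let lE := bilE (bilin_lact rV).
Let rE := bilE (bilin_ract rV).

Lemma lact_dw (x y : g) f s :
  derive_word (fun t => lact rV x (f t)) y s = lact rV x (derive_word f y s).
Proof. exact: (derive_word_comp f y s ((bilin_lact rV).2 x)). Qed.

Lemma ract_dw (x y : g) f s :
  derive_word (fun t => ract rV (f t) x) y s = ract rV (derive_word f y s) x.
Proof. exact: (derive_word_comp f y s ((bilin_ract rV).1 x)). Qed.

(** If P is the monomial of [s], the subtracted terms are the value of [f] at x P + D_x(P). The
    right action only touches the values of [f]. *)
Definition clact_fun (x : g) (f : seq g -> V) (s : seq g) : V :=
  lact rV x (f s) - f (x :: s) - derive_word f x s.

Fact clact_subproof x f :
  mlin (clact_fun x (cval f)) /\ msym (clact_fun x (cval f)).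
Proof.
have fL := @cval_mlin f; have fS := @cval_msym f.
split=> [s1 s2 c u v|s1 a b s2]; rewrite /clact_fun.
  rewrite (derive_word_mlin x fL) fL (fL (x :: s1)) !lE.
  by rewrite !(scalerDr, scalerN) !cat_cons; abel.
by rewrite (derive_word_msym x fS) fS (fS (x :: s1)).
Qed.

Fact cract_subproof x f : mlin (fun s => ract rV (cval f s) x)
  /\ msym (fun s => ract rV (cval f s) x).
Proof.
split=> [s1 s2 c u v|s1 a b s2]; last by rewrite cval_msym.
by rewrite cval_mlin !rE.
Qed.

Definition clact x f : coind := mk_coind (clact_subproof x f).
Definition cract f x : coind := mk_coind (cract_subproof x f).

Lemma clactE x f s : cval (clact x f) s =
  lact rV x (cval f s) - cval f (x :: s) - derive_word (cval f) x s.
Proof. by []. Qed.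

Lemma cractE x f s : cval (cract f x) s = ract rV (cval f s) x.
Proof. by []. Qed.

Fact clact_linearl f : linear (clact^~ f).
Proof.
move=> c x y; apply: cval_inj => s; rewrite !vE !clactE.
have fl : linear (fun a => cval f (a :: s)) by exact: (@cval_mlin f [::] s).
rewrite (derive_word_linear _ (@cval_mlin f)) (linD fl) (linZ fl) !lE.
by rewrite !(scalerDr, scalerN); abel.
Qed.

Fact clact_linearr x : linear (clact x).
Proof.
move=> c f h; apply: cval_inj => s; rewrite !vE !clactE !vE.
rewrite (@derive_word_comb _ _ _ c _ (cval f) (cval h)); last first.
  by move=> t; rewrite !vE.
by rewrite !lE !(scalerDr, scalerN); abel.
Qed.

Fact cract_linearl x : linear (cract^~ x).
Proof. by move=> c f h; apply: cval_inj => s; rewrite !vE !cractE !vE !rE. Qed.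

Fact cract_linearr f : linear (cract f).
Proof. by move=> c x y; apply: cval_inj => s; rewrite !vE !cractE !rE. Qed.

(** The terms with both letters prepended cancel by symmetry. Deriving a prepended letter gives x ∘
    y and y ∘ x, whose difference is the letter [x, y]; the rest is [derive_word_bracket]. *)
Fact clact_bracket x y f :
  clact (bracket x y) f = clact x (clact y f) - clact y (clact x f).
Proof.
apply: cval_inj => s; rewrite !vE !clactE.
have dB a b : derive_word (cval (clact b f)) a s =
  lact rV b (derive_word (cval f) a s)
  - derive_word (fun t => cval f (b :: t)) a s
  - derive_word (fun t => derive_word (cval f) b t) a s.
  rewrite -lact_dw; set h1 := fun t : seq g => lact _ _ _.
  set h2 := fun t : seq g => cval _ _.
  set h3 := fun t : seq g => derive_word _ _ _.
  rewrite (@derive_word_comb _ _ _ (-1) _ h3 (fun t => h1 t - h2 t)); last first.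
    by move=> t; rewrite scaleN1r addrC.
  rewrite (@derive_word_comb _ _ _ (-1) (fun t => h1 t - h2 t) h2 h1);
    last first.
    by move=> t; rewrite scaleN1r addrC.
  by rewrite !scaleN1r; abel.
rewrite !dB /= (derive_word_bracket x y s (@cval_mlin f)).
rewrite (@cval_msym f [::] x y s).
rewrite lact_bracket !lE /=.
have fl : linear (fun a => cval f (a :: s)) by exact: (@cval_mlin f [::] s).
rewrite {1}/bracket (linD fl) (linN fl).
by abel.
Qed.

Fact clact_cract x y f :
  cract (clact x f) y - clact x (cract f y) =
  cract (cract f x) y - cract f (x ∘ y).
Proof.
apply: cval_inj => s; rewrite !vE !(clactE, cractE).
rewrite (derive_word_eq (f := cval (cract f y))
  (h := fun t => ract rV (cval f t) y)) // ract_dw !rE.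
by rewrite -lact_ract; abel.
Qed.

Definition crep : representation g coind :=
  Representation clact_linearl clact_linearr cract_linearl cract_linearr
    clact_bracket clact_cract.

(** The augmentation S(g) -> k times [v]. This embeds V as a subrepresentation because x P + D_x(P)
    has no constant term. *)
Definition aug_fun (v : V) (s : seq g) : V := if s is [::] then v else 0.

Fact aug_subproof v : mlin (aug_fun v) /\ msym (aug_fun v).
Proof.
split=> [s1 s2 c u w|s1 a b s2]; last by case: s1.
by case: s1 => [|x s1]; rewrite /= scaler0 addr0.
Qed.

Definition aug v : coind := mk_coind (aug_subproof v).

Lemma aug_linear : linear aug.
Proof.
move=> c u v; apply: cval_inj => -[|x s]; rewrite !vE //=.
by rewrite scaler0 addr0.
Qed.

Lemma aug_inj : injective aug.
Proof. by move=> u v /(congr1 (fun f => cval f [::])). Qed.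

Lemma clact_aug x v : clact x (aug v) = aug (lact rV x v).
Proof.
apply: cval_inj => -[|y s]; rewrite clactE; first by rewrite /= !subr0.
rewrite derive_word0; last by case.
by rewrite /= lE !subr0.
Qed.

Lemma cract_aug x v : cract (aug v) x = aug (ract rV v x).
Proof. by apply: cval_inj => -[|y s]; rewrite cractE //= rE. Qed.

(** * Solving the coboundary equation degree by degree *)

Section Efface.
Variable (t : g -> g -> g -> V).
Hypotheses (tA : alternating3 t)
  (tC : forall x y z w, cob3 (lact rV) (ract rV) t x y z w = 0).

Notation D2 := (cob2 (lact crep) (ract crep)).

Definition residue (s : g -> g -> coind) x y z : coind :=
  aug (t x y z) - D2 s x y z.

Lemma D2_val s x y z p : cval (D2 s x y z) p =
  lact rV x (cval (s y z) p) - cval (s y z) (x :: p)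
  - derive_word (cval (s y z)) x p
  - (lact rV y (cval (s x z) p) - cval (s x z) (y :: p)
  - derive_word (cval (s x z)) y p)
  + ract rV (cval (s y x) p) z - ract rV (cval (s x y) p) z
  - cval (s y (x ∘ z)) p + cval (s x (y ∘ z)) p - cval (s (bracket x y) z) p.
Proof. by rewrite /cob2 !vE !clactE !cractE. Qed.

(** The action prepends at most one letter and derivations preserve length. *)
Lemma D2_local s s' x y z p :
  (forall a b q, size q = size p \/ size q = (size p).+1 ->
    cval (s a b) q = cval (s' a b) q) ->
  cval (D2 s x y z) p = cval (D2 s' x y z) p.
Proof.
move=> ss'; rewrite !D2_val.
have dE a b c :
    derive_word (cval (s a b)) c p = derive_word (cval (s' a b)) c p.
  by apply: derive_word_eq => q qp; apply: ss'; left.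
by rewrite !dE !ss' //=; do ?[by left|by right].
Qed.

Lemma residue_cocycle s x y z w : bilin s ->
  cob3 (lact crep) (ract crep) (residue s) x y z w = 0.
Proof.
move=> sL; have lL := bilin_lact crep; have rL := bilin_ract crep.
have -> : cob3 (lact crep) (ract crep) (residue s) x y z w =
    cob3 (lact crep) (ract crep) (fun a b c => aug (t a b c)) x y z w
    - cob3 (lact crep) (ract crep) (D2 s) x y z w.
  rewrite /cob3 /residue; move: (D2 s) => T.
  by rewrite !(bilE lL, bilE rL); abel.
rewrite (_ : cob3 _ _ (fun a b c => _) x y z w = 0); last first.
  rewrite -(lin0 aug_linear) -(tC x y z w) /cob3.
  rewrite !(linD aug_linear, linN aug_linear) -!clact_aug -!cract_aug.
  by [].
rewrite sub0r; apply/eqP; rewrite oppr_eq0; apply/eqP.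
exact: (cob3_cob2 (rep_action crep sL)).
Qed.

Lemma residue_alternating s : bilin s ->
  [/\ forall y z, linear (fun x => residue s x y z),
      forall x z, linear (fun y => residue s x y z),
      forall x y, linear (residue s x y)
    & forall x z, residue s x x z = 0].
Proof.
move=> sL; have [t1 t2 t3 t0] := tA.
have [d1 d2 d3 d0] := cob2_alternating (bilin_lact crep) (bilin_ract crep) sL.
rewrite /residue; split=> [y z c u v|x z c u v|x y c u v|x z].
- rewrite t1 d1 (linD aug_linear) (linZ aug_linear).
  by rewrite !(scalerDr, scalerN); abel.
- rewrite t2 d2 (linD aug_linear) (linZ aug_linear).
  by rewrite !(scalerDr, scalerN); abel.
- rewrite t3 d3 (linD aug_linear) (linZ aug_linear).
  by rewrite !(scalerDr, scalerN); abel.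
- by rewrite t0 d0 (lin0 aug_linear) subr0.
Qed.

Lemma residue_anti s x y z : bilin s -> residue s x y z = - residue s y x z.
Proof.
move=> /residue_alternating[r1 r2 _ r0]; have := r0 (x + y) z.
rewrite (linD (r1 _ _)) !(linD (r2 _ _)) !r0 add0r addr0 => /eqP.
by rewrite addr_eq0 => /eqP.
Qed.

Definition solved_below n s : Prop := bilin s /\
  forall x y z p, (size p < n)%N -> cval (residue s x y z) p = 0.

(** In the cocycle identity at [p], all terms of the degree of [p] vanish; those with a prepended
    letter remain and form the Koszul differential. *)
Lemma residue_cyclic n s x y w z p : solved_below n s ->
  (size p < n)%N ->
  cval (residue s x y z) (w :: p) + cval (residue s y w z) (x :: p)
  + cval (residue s w x z) (y :: p) = 0.
Proof.
move=> [sL s0] pn; move: (residue_anti w x z sL) (residue_cocycle x y w z sL).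
move: (residue s) s0 => T s0 Tanti /(congr1 (cval^~ p)).
rewrite /cob3 !vE !clactE !cractE.
have r0 a b c : cval (T a b c) p = 0 by apply: s0.
have d0 a b c e : derive_word (cval (T a b c)) e p = 0.
  by apply: derive_word0 => q qp; apply: s0; rewrite qp.
rewrite !r0 !d0 !(lE, rE) Tanti !vE => /(congr1 -%R).
by rewrite oppr0 => <-; abel.
Qed.

(** The component of degree [n] of the residue, as a Koszul cochain in the two alternating
    arguments, with [z] as a parameter. *)
Definition koszul_data n s z x y p : V :=
  if size p == n then cval (residue s x y z) p else 0.

Fact correction_subproof n s x z :
  mlin (koszul (koszul_data n s z) x) /\ msym (koszul (koszul_data n s z) x).
Proof.
split; first exact: koszul_mlin.
apply: koszul_msym => a b s1 c d s2; rewrite /koszul_data !size_cat /=.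
by case: ifP => // _; apply: cval_msym.
Qed.

Definition correction n s (x z : g) : coind :=
  mk_coind (correction_subproof n s x z).

Lemma correction_degree n s x z p : size p != n.+1 ->
  cval (correction n s x z) p = 0.
Proof.
by apply: koszul_degree => a b q qn; rewrite /koszul_data (negPf qn).
Qed.

Lemma correction_bilin n s : bilin s -> bilin (correction n s).
Proof.
move=> sL; have [_ _ r3 _] := residue_alternating sL.
split=> [z c x y|x c y z]; apply: cval_inj => p; rewrite !vE.
  exact: koszul_linear.
apply: koszul_comb => a b q; rewrite /koszul_data r3 !vE.
by case: ifP; rewrite ?scaler0 ?addr0.
Qed.

Lemma correction_solves n s x y z p : solved_below n s ->
  cval (correction n s x z) (y :: p) - cval (correction n s y z) (x :: p) =
  koszul_data n s z x y p.
Proof.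
move=> sS; have sL := sS.1; have [r1 r2 r3 r0] := residue_alternating sL.
apply: koszul_solves; rewrite /koszul_data.
- move=> b q c u v; rewrite r1 !vE.
  by case: ifP; rewrite ?scaler0 ?addr0.
- move=> b q c u v; rewrite r2 !vE.
  by case: ifP; rewrite ?scaler0 ?addr0.
- move=> a b s1 s2 c u v; rewrite !size_cat /=.
  by case: ifP => _; [apply: cval_mlin|rewrite scaler0 addr0].
- move=> a b s1 c e s2; rewrite !size_cat /=.
  by case: ifP => _ //; apply: cval_msym.
- by move=> a q; rewrite r0 vE if_same.
- move=> a b q; rewrite (residue_anti a b z sL) vE.
  by case: ifP => _; rewrite ?oppr0.
move=> a b c q /=; case: eqP => [qn|_]; last by rewrite !addr0.
by apply: residue_cyclic sS _; rewrite -qn.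
Qed.

Definition improve n s x z : coind := s x z + correction n s x z.

(** The correction lives in degree n + 1, so the residue is unchanged below degree n. In degree n
    only the terms of its coboundary with a prepended letter survive, and they equal the residue by
    [correction_solves]. *)
Lemma improve_solved n s : solved_below n s -> solved_below n.+1 (improve n s).
Proof.
move=> sS; have [sL s0] := sS; have cL := correction_bilin n sL.
split=> [|x y z p].
  split=> [z c x y|x c y z]; rewrite /improve.
    by rewrite !(bilE sL, bilE cL) scalerDr addrACA.
  by rewrite !(bilE sL, bilE cL) scalerDr addrACA.
rewrite ltnS leq_eqVlt => /predU1P[pn|pn]; last first.
  rewrite -(s0 x y z p pn) /residue !vE; congr (_ - _).
  apply: D2_local => a b q qp; rewrite vE correction_degree ?addr0 //.
  by case: qp => ->; rewrite ?eqSS ltn_eqF // ltnW.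
rewrite /residue /improve cob2_D; [|exact: bilin_lact|exact: bilin_ract].
rewrite opprD addrA (linD (cval_linear p)) -/(residue s x y z).
rewrite (linN (cval_linear p)) D2_val.
have c0 a b : cval (correction n s a b) p = 0.
  by rewrite correction_degree // pn neq_ltn ltnSn.
have d0 a b c : derive_word (cval (correction n s a b)) c p = 0.
  apply: derive_word0 => q qp.
  by rewrite correction_degree // qp pn neq_ltn ltnSn.
have := correction_solves x y z p sS; rewrite /koszul_data pn eqxx => <-.
by rewrite !c0 !d0 !(lE, rE); abel.
Qed.

Fixpoint approx n : g -> g -> coind :=
  if n is m.+1 then improve m (approx m) else fun _ _ => 0.

Lemma approx_solved n : solved_below n (approx n).
Proof.
elim: n => [|n /improve_solved //]; split=> //.
by split=> [y|x] c u v; rewrite scaler0 addr0.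
Qed.

(** Passing from stage n to n + 1 alters degree n + 1 only, so each degree is eventually constant
    and the limit [solution] makes sense. *)
Lemma approx_stable n x z p : (size p <= n)%N ->
  cval (approx n x z) p = cval (approx (size p) x z) p.
Proof.
elim: n => [|n IHn]; first by rewrite leqn0 => /eqP->.
rewrite leq_eqVlt => /predU1P[-> //|]; rewrite ltnS => pn.
by rewrite -IHn //= vE correction_degree ?addr0 // ltn_eqF.
Qed.

Fact solution_subproof x z : mlin (fun p => cval (approx (size p) x z) p)
  /\ msym (fun p => cval (approx (size p) x z) p).
Proof.
split=> [s1 s2 c u v|s1 a b s2]; rewrite !size_cat /=; first exact: cval_mlin.
exact: cval_msym.
Qed.

Definition solution x z : coind := mk_coind (solution_subproof x z).

Lemma solution_bilin : bilin solution.
Proof.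
have E p x z : cval (solution x z) p = cval (approx (size p) x z) p by [].
split=> [z c x y|x c y z]; apply: cval_inj => p; rewrite !vE !E.
  by rewrite !(bilE (approx_solved (size p)).1) !vE.
by rewrite !(bilE (approx_solved (size p)).1) !vE.
Qed.

(** At [p] the coboundary sees only degrees up to [(size p).+1], where [solution] agrees with an
    approximation whose residue vanishes at [p]. *)
Lemma efface x y z : D2 solution x y z = aug (t x y z).
Proof.
apply: cval_inj => p.
have [_ /(_ x y z p (leqnn _))] := approx_solved (size p).+1.
rewrite /residue !vE => /eqP; rewrite subr_eq0 => /eqP->.
apply: D2_local => a b q qp; apply/esym/approx_stable.
by case: qp => ->.
Qed.

End Efface.
End CoinducedModule.

Section Surjectivity.
Variables (k : fieldType) (g : preLieType k) (V : lmodType k).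
Variable rV : representation g V.

Lemma cocycle_is_class t : alternating3 t ->
  (forall x y z w, cob3 (lact rV) (ract rV) t x y z w = 0) ->
  exists E, is_class rV E t.
Proof.
move=> tA tC; pose A := rep_action (crep rV) (solution_bilin tA tC).
have jwl x v : wl A x (aug g v) = aug g (lact rV x v) by apply: clact_aug.
have jwr x v : wr A (aug g v) x = aug g (ract rV v x) by apply: cract_aug.
pose D := @CrossedDatum _ _ _ rV (zero_preLie (coind g V)) A _ t
  (@aug_linear _ g V) (@aug_inj _ g V) (fun _ _ => erefl) (fun _ _ => erefl) jwl jwr
  (efface tA tC).
by exists (realization D); apply: (is_class_realization D).
Qed.

End Surjectivity.

(** * The bijection *)

Section ClassesBijection.
Variables (T T' : Type) (D : T -> Prop) (D' : T' -> Prop).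
Variables (R : T -> T -> Prop) (R' : T' -> T' -> Prop).

Lemma class_eq (c c' : classes D R) : class_pred c = class_pred c' -> c = c'.
Proof.
case: c c' => [p pP] [q qP] /= e; case: _ / e in qP *.
by congr Class; apply: Prop_irrelevance.
Qed.

Definition class_of x (Dx : D x) : classes D R :=
  Class (ex_intro2 _ _ x Dx erefl).

Lemma class_of_eq : (forall x, R x x) -> (forall x y, R x y -> R y x) ->
  (forall x y z, R x y -> R y z -> R x z) ->
  forall x y (Dx : D x) (Dy : D y), class_of Dx = class_of Dy <-> R x y.
Proof.
move=> Rr Rs Rt x y Dx Dy; split=> [/(congr1 (@class_pred _ _ _))/= e|xy].
  by rewrite e; apply: Rr.
apply/class_eq/funext => z; apply/propext; split; last exact: Rt.
by apply: Rt; apply: Rs.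
Qed.

End ClassesBijection.

(** The correspondence [S] induces a relation [G] between classes that is total on both sides and,
    by the last hypothesis, one-to-one; choice in each direction gives inverse maps. *)
Lemma classes_bijection (T T' : Type) (D : T -> Prop) (D' : T' -> Prop)
    (R : T -> T -> Prop) (R' : T' -> T' -> Prop) (S : T -> T' -> Prop) :
  (forall x, R x x) -> (forall x y, R x y -> R y x) ->
  (forall x y z, R x y -> R y z -> R x z) ->
  (forall x, R' x x) -> (forall x y, R' x y -> R' y x) ->
  (forall x y z, R' x y -> R' y z -> R' x z) ->
  (forall x, D x -> exists2 y, D' y & S x y) ->
  (forall y, D' y -> exists2 x, D x & S x y) ->
  (forall x x' y y', S x y -> S x' y' -> R x x' <-> R' y y') ->
  exists F : classes D R -> classes D' R', bijective F.
Proof.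
move=> Rr Rs Rt Rr' Rs' Rt' SD SD' SR.
have cP (c : classes D R) : exists x (Dx : D x), c = class_of R Dx.
  by case: (class_predP c) => x Dx cx; exists x, Dx; apply: class_eq.
have cP' (c : classes D' R') : exists y (Dy : D' y), c = class_of R' Dy.
  by case: (class_predP c) => y Dy cy; exists y, Dy; apply: class_eq.
pose G (c : classes D R) (c' : classes D' R') :=
  exists x y (Dx : D x) (Dy : D' y), [/\ c = class_of R Dx,
    c' = class_of R' Dy & S x y].
have /choice[F FP] : forall c, exists c', G c c'.
  move=> c; have [x [Dx ->]] := cP c; have [y Dy xy] := SD x Dx.
  by exists (class_of R' Dy), x, y, Dx, Dy.
have /choice[H HP] : forall c', exists c, G c c'.
  move=> c; have [y [Dy ->]] := cP' c; have [x Dx xy] := SD' y Dy.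
  by exists (class_of R Dx), x, y, Dx, Dy.
have GG c1 c1' c2 c2' : G c1 c1' -> G c2 c2' -> c1 = c2 <-> c1' = c2'.
  move=> [x [y [Dx [Dy [-> -> xy]]]]] [x' [y' [Dx' [Dy' [-> -> xy']]]]].
  rewrite (class_of_eq Rr Rs Rt) (class_of_eq Rr' Rs' Rt').
  exact: SR.
exists F, H => c.
  by apply/(GG _ _ _ _ (HP (F c)) (FP c)).
by apply/(GG _ _ _ _ (FP (H c)) (HP c)).
Qed.

Unset Implicit Arguments.
Theorem theorem3p2 (k : fieldType) (g : preLieType k) (V : lmodType k)
    (rV : representation g V) :
  exists F : CExt rV -> cohomology rV 3, bijective F.
Proof.
pose S (E : cm_extension g V) (f : cochain g V 2) := is_class rV E (fun3 f).
have lL := bilin_lact rV; have rL := bilin_ract rV.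
apply: (@classes_bijection _ _ _ _ _ _ S).
- exact: Relation_Operators.rst_refl.
- exact: Relation_Operators.rst_sym.
- exact: Relation_Operators.rst_trans.
- move=> f; apply/cohomologousP; exists (fun _ _ => 0).
    by split=> [y|x] c u v; rewrite scaler0 addr0.
  by move=> x y z; rewrite cob2_0 ?addr0.
- move=> f f' /cohomologousP[h hL hE]; apply/cohomologousP.
  exists (fun a b => - h a b).
    by split=> [y|x] c u v; rewrite (bilE hL) (bilE hL) opprD scalerN.
  by move=> x y z; rewrite cob2_N // hE addrK.
- move=> f f' f'' /cohomologousP[h hL hE] /cohomologousP[h' hL' hE'].
  apply/cohomologousP; exists (fun a b => h a b + h' a b).
    by split=> [y|x] c u v; rewrite !(bilE hL, bilE hL') scalerDr addrACA.
  by move=> x y z; rewrite cob2_D // addrA -hE -hE'.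
- move=> E /is_class_exists[t tA Et]; exists (cochain2 tA); last exact: Et.
  by apply/cocycleP => x y z w; apply: is_class_cocycle Et.
- move=> f /cocycleP fC.
  have [E EP] := cocycle_is_class (fun3_alternating f) fC.
  by exists E => //; have [rho [s [? ? _ _]]] := EP; exists rho.
(* Equivalent extensions share their classes, which are cohomologous by uniqueness. Conversely,
   shifting the class of [E] by a coboundary reduces to two extensions with the same class. *)
move=> E E' f f' Ef Ef'; split=> [EE'|/cohomologousP[h hL hE]].
  have Ef1 : is_class rV E' (fun3 f) by apply/(ext_equiv_is_class _ _ EE').
  apply/cohomologousP; exact: is_class_unique Ef1 Ef'.
apply: is_class_equiv Ef'.
have -> : fun3 f' =
    fun x y z => fun3 f x y z + cob2 (lact rV) (ract rV) h x y z.
  by apply/funext => x; apply/funext => y; apply/funext => z.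
exact: is_class_shift.
Qed.
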